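(* Let $\mathbb K$ be an algebraically closed field of characteristic $5$. For each of the Lie superalgebras $\mathfrak g=\mathfrak{osp}(1|8)$, $\mathfrak{osp}(2|6)$, $\mathfrak{osp}(3|6)$, $\mathfrak{osp}(4|4)$, $\mathfrak{osp}(5|2)$ over $\mathbb K$, we have $H^1(\mathfrak g;\mathfrak g)=H^2(\mathfrak g)=0$.
   Context: $\mathfrak{osp}(m|2n)$ is the Lie superalgebra of supermatrices preserving a non-degenerate even supersymmetric bilinear form on $\mathbb K^{m|2n}$ (symmetric on the even part, antisymmetric on the odd part). $H^1(\mathfrak g;\mathfrak g)$ is the superspace of all (even and odd) derivations modulo inner ones. $H^2(\mathfrak g)$ is the second cohomology with trivial coefficients (both parities): super-antisymmetric bilinear forms $\omega$ with $\omega([x,y],z)=\omega(x,[y,z])-(-1)^{p(x)p(y)}\omega(y,[x,z])$ modulo the forms $f([x,y])$ with $f$ linear. *)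

(* Defs.v *)
From HB Require Import structures.
From mathcomp Require Import all_boot all_order all_algebra.
From mathcomp Require Import ring.

Set Implicit Arguments.
Unset Strict Implicit.
Unset Printing Implicit Defensive.

Import GRing.Theory.
Local Open Scope ring_scope.

(* Parities are booleans ([true] is odd): the sum of p and q is [p (+) q] and
   the sign (-1)^(pq) is [(-1) ^+ (p && q)].  These axioms are the appropriate
   ones only away from characteristics 2 and 3, where further axioms on the odd
   part are required. *)
Record lieSuperalgebra (K : fieldType) := LieSuperalgebra {
  lsa_vect :> vectType K;
  lsa_part : bool -> {vspace lsa_vect};
  lsa_br : {bilinear lsa_vect -> lsa_vect -> lsa_vect};
  lsa_part_full : (lsa_part false + lsa_part true = fullv)%VS;
  lsa_part_direct : (lsa_part false :&: lsa_part true = 0)%VS;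
  lsa_br_part : forall p q x y, x \in lsa_part p -> y \in lsa_part q ->
    lsa_br x y \in lsa_part (p (+) q);
  lsa_br_antisym : forall p q x y, x \in lsa_part p -> y \in lsa_part q ->
    lsa_br x y = - ((-1) ^+ (p && q) *: lsa_br y x);
  lsa_jacobi : forall p q x y z, x \in lsa_part p -> y \in lsa_part q ->
    lsa_br x (lsa_br y z)
    = lsa_br (lsa_br x y) z + (-1) ^+ (p && q) *: lsa_br y (lsa_br x z)
}.

Section Cohomology.

Variables (K : fieldType) (g : lieSuperalgebra K).
Local Notation "[~ x , y ]" := (lsa_br g x y).

Definition homogeneous_derivation (p : bool) (D : 'End(g)) : Prop :=
  (forall q x, x \in lsa_part g q -> D x \in lsa_part g (p (+) q)) /\
  (forall q x y, x \in lsa_part g q ->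
     D [~ x, y] = [~ D x, y] + (-1) ^+ (p && q) *: [~ x, D y]).

Definition derivation (D : 'End(g)) : Prop :=
  exists D0 D1 : 'End(g),
    [/\ homogeneous_derivation false D0, homogeneous_derivation true D1
      & D = D0 + D1].

Definition inner_derivation (D : 'End(g)) : Prop :=
  exists x : g, forall y, D y = [~ x, y].

(* H^1(g; g) is the quotient of the space of derivations by its subspace of
   inner ones (see [inner_is_derivation] below). *)
Definition H1_adjoint_eq0 : Prop :=
  forall D : 'End(g), derivation D -> inner_derivation D.

(* Forms of both parities (and their sums) are covered: neither condition
   involves the parity of [w]. *)
Definition cocycle2 (w : {bilinear g -> g -> K | *%R & *%R}) : Prop :=
  (forall p q x y, x \in lsa_part g p -> y \in lsa_part g q ->
     w x y = - ((-1) ^+ (p && q) * w y x)) /\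
  (forall p q x y z, x \in lsa_part g p -> y \in lsa_part g q ->
     w [~ x, y] z = w x [~ y, z] - (-1) ^+ (p && q) * w y [~ x, z]).

Definition coboundary2 (w : {bilinear g -> g -> K | *%R & *%R}) : Prop :=
  exists f : {scalar g}, forall x y, w x y = f [~ x, y].

(* H^2(g) is the quotient of the cocycles by the coboundaries (see
   [coboundary_is_cocycle] below). *)
Definition H2_trivial_eq0 : Prop :=
  forall w : {bilinear g -> g -> K | *%R & *%R}, cocycle2 w -> coboundary2 w.

Lemma coboundary_is_cocycle w : coboundary2 w -> cocycle2 w.
Proof.
case=> f wf; split=> [p q x y xp yq|p q x y z xp yq].
  by rewrite !wf (lsa_br_antisym xp yq) linearN linearZ.
by rewrite !wf (lsa_jacobi z xp yq) linearD linearZ /= addrK.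
Qed.

Lemma inner_is_derivation D : inner_derivation D -> derivation D.
Proof.
case=> x Dx.
have /memv_addP[x0 x0P [x1 x1P xE]] :
    x \in (lsa_part g false + lsa_part g true)%VS.
  by rewrite lsa_part_full memvf.
have adP p u : u \in lsa_part g p ->
    homogeneous_derivation p (linfun (lsa_br g u)).
  move=> uP; split=> [q y yq|q y z yq]; rewrite !lfunE /=.
    exact: lsa_br_part.
  exact: lsa_jacobi.
exists (linfun (lsa_br g x0)), (linfun (lsa_br g x1)).
split; [exact: adP | exact: adP |].
by apply/lfunP=> y; rewrite Dx add_lfunE !lfunE /= xE linearDl.
Qed.

End Cohomology.

Section Supermatrices.

Variables (K : fieldType) (m k : nat).
Implicit Types (X Y : 'M[K]_(m + k)) (p q : bool).

Definition spart p X : 'M[K]_(m + k) :=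
  if p then block_mx 0 (ursubmx X) (dlsubmx X) 0
  else block_mx (ulsubmx X) 0 0 (drsubmx X).

(* The bilinear extension of [X, Y] = X Y - (-1)^(p(X) p(Y)) Y X. *)
Definition sbracket X Y : 'M[K]_(m + k) :=
  X *m Y -
  \sum_(p : bool) \sum_(q : bool)
     (-1) ^+ (p && q) *: (spart q Y *m spart p X).

Definition vec_part q (u : 'cV[K]_(m + k)) : 'cV[K]_(m + k) :=
  if q then col_mx 0 (dsubmx u) else col_mx (usubmx u) 0.

(* The Gram matrix of a non-degenerate even supersymmetric bilinear form on
   K^(m|k): block diagonal, symmetric on the even part, antisymmetric on the
   odd part (so that k is even when the characteristic is not 2). *)
Record superform := Superform {
  gram :> 'M[K]_(m + k);
  gram_nondegenerate : gram \in unitmx;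
  gram_even : ursubmx gram = 0 /\ dlsubmx gram = 0;
  gram_sym : (ulsubmx gram)^T = ulsubmx gram;
  gram_antisym : (drsubmx gram)^T = - drsubmx gram
}.

Implicit Type B : superform.

Definition form_eval B (u v : 'cV[K]_(m + k)) : K :=
  (u^T *m B *m v) 0 0.

Definition sgnmx p : 'M[K]_(m + k) := block_mx 1%:M 0 0 ((-1) ^+ p)%:M.

Definition preserve_defect B p X : 'M[K]_(m + k) :=
  (spart p X)^T *m B + sgnmx p *m B *m spart p X.

Lemma spart_is_linear p : linear (spart p).
Proof.
move=> a X Y; rewrite -[X]submxK -[Y]submxK /spart.
case: p; rewrite !(scale_block_mx, add_block_mx, block_mxKul, block_mxKur,
  block_mxKdl, block_mxKdr) !scaler0 !addr0; reflexivity.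
Qed.
HB.instance Definition _ p :=
  GRing.isLinear.Build K _ _ _ (spart p) (spart_is_linear p).

Lemma preserve_defect_is_linear B p : linear (preserve_defect B p).
Proof.
move=> a X Y; rewrite /preserve_defect !linearP /= mulmxDl -scalemxAl.
by rewrite scalerDr addrACA.
Qed.
HB.instance Definition _ B p :=
  GRing.isLinear.Build K _ _ _ (preserve_defect B p)
    (preserve_defect_is_linear B p).

(* The supermatrices X whose homogeneous components X_p preserve the form:
   B(X_p u, v) + (-1)^(p p(u)) B(u, X_p v) = 0; see [osp_spaceP]. *)
Definition osp_space B : {vspace 'M[K]_(m + k)} :=
  (lker (linfun (preserve_defect B false))
   :&: lker (linfun (preserve_defect B true)))%VS.

Lemma osp_space_defect B X :
  reflect (forall p, preserve_defect B p X = 0) (X \in osp_space B).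
Proof.
rewrite memv_cap !memv_ker !lfunE /=.
apply: (iffP andP) => [[/eqP X0 /eqP X1] []|X0] //.
by rewrite !X0 eqxx.
Qed.

Lemma spart_sum X : X = spart false X + spart true X.
Proof. by rewrite add_block_mx !addr0 !add0r submxK. Qed.

Lemma spartK p q X : spart p (spart q X) = if p == q then spart q X else 0.
Proof.
by case: p; case: q; rewrite /spart /= ?(block_mxKul, block_mxKur, block_mxKdl,
  block_mxKdr) ?block_mx0.
Qed.

Lemma vec_part_sum u : u = vec_part false u + vec_part true u.
Proof. by rewrite add_col_mx addr0 add0r vsubmxK. Qed.

Lemma vec_part_sgn p q u :
  (vec_part q u)^T *m sgnmx p = (-1) ^+ (p && q) *: (vec_part q u)^T.
Proof.
rewrite /vec_part /sgnmx; case: q; rewrite tr_col_mx mul_row_block trmx0.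
  by rewrite !(mul0mx, mulmx0, add0r) andbT mul_mx_scalar scale_row_mx scaler0.
by rewrite !(mul0mx, mulmx0, addr0) andbF mulmx1 scale1r.
Qed.

Lemma osp_spaceP B X :
  X \in osp_space B <->
  (forall p q u v,
     form_eval B (spart p X *m vec_part q u) v
     + (-1) ^+ (p && q) * form_eval B (vec_part q u) (spart p X *m v) = 0).
Proof.
have addE (S T : 'M[K]_1) : (S + T) 0 0 = S 0 0 + T 0 0 by rewrite mxE.
have trD (u v : 'cV[K]_(m + k)) : (u + v)^T = u^T + v^T by rewrite linearD.
have scaleE a (S : 'M[K]_1) : (a *: S) 0 0 = a * S 0 0 by rewrite mxE.
have E p q u v :
    form_eval B (spart p X *m vec_part q u) v
    + (-1) ^+ (p && q) * form_eval B (vec_part q u) (spart p X *m v)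
    = ((vec_part q u)^T *m preserve_defect B p X *m v) 0 0.
  rewrite /form_eval /preserve_defect mulmxDr mulmxDl addE trmx_mul !mulmxA.
  by rewrite vec_part_sgn -!scalemxAl scaleE.
split=> [/osp_space_defect X0 p q u v|X0].
  by rewrite E X0 mulmx0 mul0mx mxE.
apply/osp_space_defect => p; apply/matrixP => i j; rewrite [RHS]mxE.
have -> : preserve_defect B p X i j
    = ((delta_mx i 0 : 'cV_(m + k))^T *m preserve_defect B p X
       *m (delta_mx j 0 : 'cV_(m + k))) 0 0.
  by rewrite trmx_delta -rowE -colE !mxE.
rewrite [X in X^T](vec_part_sum (delta_mx i 0)) trD !mulmxDl addE.
by rewrite -!E !X0 addr0.
Qed.

Definition shom p X := spart p X == X.

Lemma shom_spart p X : shom p (spart p X).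
Proof. by rewrite /shom spartK eqxx. Qed.

Lemma shomM p q X Y : shom p X -> shom q Y -> shom (p (+) q) (X *m Y).
Proof.
move=> /eqP <- /eqP <-; rewrite /shom /spart.
by case: p; case: q; rewrite /= mulmx_block !(mulmx0, mul0mx, addr0, add0r)
  !(block_mxKul, block_mxKur, block_mxKdl, block_mxKdr).
Qed.

Lemma spart_shom p q X : shom q X -> spart p X = if p == q then X else 0.
Proof. by move=> /eqP <-; rewrite spartK. Qed.

Lemma sbracket_shom p q X Y : shom p X -> shom q Y ->
  sbracket X Y = X *m Y - (-1) ^+ (p && q) *: (Y *m X).
Proof.
move=> Xp Yq; rewrite /sbracket; congr (_ - _).
rewrite (bigD1 p) //= (bigD1 q) //= [X in _ + X + _]big1; last first.
  move=> r /negPf rq.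
  by rewrite (spart_shom _ Yq) rq mul0mx scaler0.
rewrite [X in _ + X]big1; last first.
  move=> r /negPf rp; apply: big1 => s _.
  by rewrite (spart_shom _ Xp) rp mulmx0 scaler0.
by rewrite !addr0 (spart_shom _ Xp) (spart_shom _ Yq) !eqxx.
Qed.

Lemma sbracket_bilinear : bilinear_for *:%R *:%R sbracket.
Proof.
pose T p q X Y := (-1) ^+ (p && q) *: (spart q Y *m spart p X).
have opp_sum a (S S' : 'M[K]_(m + k)) : - (a *: S + S') = a *: (- S) + - S'.
  by rewrite scalerN opprD.
have sumP a (F F' G : bool -> bool -> 'M[K]_(m + k)) :
    (forall p q, G p q = a *: F p q + F' p q) ->
    \sum_p \sum_q G p q = a *: (\sum_p \sum_q F p q) + \sum_p \sum_q F' p q.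
  move=> GE; rewrite scaler_sumr -big_split /=; apply: eq_bigr => p _.
  by rewrite scaler_sumr -big_split /=; apply: eq_bigr => q _.
split=> [Y a X X'|X a Y Y']; rewrite /sbracket /=.
  rewrite mulmxDl -scalemxAl.
  rewrite [X in - X](sumP a (fun p q => T p q X Y) (fun p q => T p q X' Y)).
    by rewrite opp_sum scalerDr addrACA.
  move=> p q; rewrite /T linearP mulmxDr scalerDr -scalemxAr !scalerA.
  by rewrite [a * _]mulrC.
rewrite mulmxDr -scalemxAr.
rewrite [X in - X](sumP a (fun p q => T p q X Y) (fun p q => T p q X Y')).
  by rewrite opp_sum scalerDr addrACA.
move=> p q; rewrite /T linearP mulmxDl scalerDr -scalemxAl !scalerA.
by rewrite [a * _]mulrC.
Qed.

Lemma sbracketDl X X' Y :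
  sbracket (X + X') Y = sbracket X Y + sbracket X' Y.
Proof.
by have /= := sbracket_bilinear.1 Y 1 X X'; rewrite !scale1r.
Qed.

Lemma sbracketDr X Y Y' :
  sbracket X (Y + Y') = sbracket X Y + sbracket X Y'.
Proof.
by have /= := sbracket_bilinear.2 X 1 Y Y'; rewrite !scale1r.
Qed.

Lemma shomP p X : reflect (spart (~~ p) X = 0) (shom p X).
Proof.
apply: (iffP idP) => [/spart_shom->|X0]; first by case: p.
by rewrite /shom [X in _ == X]spart_sum; case: p X0 => /= ->;
  rewrite ?add0r ?addr0.
Qed.

Lemma sbracket_antisym p q X Y : shom p X -> shom q Y ->
  sbracket X Y = - ((-1) ^+ (p && q) *: sbracket Y X).
Proof.
move=> Xp Yq; rewrite (sbracket_shom Xp Yq) (sbracket_shom Yq Xp) andbC.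
by rewrite scalerBr scalerA -signr_addb addbb scale1r opprB.
Qed.

Lemma sbracket_hom p q X Y : shom p X -> shom q Y ->
  shom (p (+) q) (sbracket X Y).
Proof.
move=> Xp Yq; rewrite (sbracket_shom Xp Yq) /shom linearB linearZ /=.
have /eqP -> := shomM Xp Yq; rewrite addbC.
by have /eqP -> := shomM Yq Xp.
Qed.

Lemma sbracket_jacobi_hom p q r X Y Z : shom p X -> shom q Y -> shom r Z ->
  sbracket X (sbracket Y Z)
  = sbracket (sbracket X Y) Z + (-1) ^+ (p && q) *: sbracket Y (sbracket X Z).
Proof.
move=> Xp Yq Zr.
rewrite (sbracket_shom Xp (sbracket_hom Yq Zr)).
rewrite (sbracket_shom (sbracket_hom Xp Yq) Zr).
rewrite (sbracket_shom Yq (sbracket_hom Xp Zr)).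
rewrite (sbracket_shom Xp Yq) (sbracket_shom Xp Zr) (sbracket_shom Yq Zr).
rewrite !(mulmxBl, mulmxBr, scalerBr, =^~ scalemxAl, =^~ scalemxAr, scalerA,
  mulmxA).
move: (X *m Y *m Z) (X *m Z *m Y) (Y *m X *m Z) (Y *m Z *m X)
  (Z *m X *m Y) (Z *m Y *m X) => S1 S2 S3 S4 S5 S6.
apply/matrixP => i j; rewrite !mxE.
by case: p {Xp}; case: q {Yq}; case: r {Zr} => /=;
  rewrite ?expr0 ?expr1; ring.
Qed.

Lemma sbracket_jacobi p q X Y Z : shom p X -> shom q Y ->
  sbracket X (sbracket Y Z)
  = sbracket (sbracket X Y) Z + (-1) ^+ (p && q) *: sbracket Y (sbracket X Z).
Proof.
move=> Xp Yq.
have := sbracket_jacobi_hom Xp Yq (shom_spart true Z).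
have := sbracket_jacobi_hom Xp Yq (shom_spart false Z).
rewrite [in X in _ -> _ -> X](spart_sum Z).
move: (spart false Z) (spart true Z) => Z0 Z1 J0 J1.
rewrite !(sbracketDr _ Z0 Z1) (sbracketDr X (sbracket Y Z0)) J0 J1.
rewrite (sbracketDr Y (sbracket X Z0)).
move: (sbracket Y (sbracket X Z0)) (sbracket Y (sbracket X Z1))
  (sbracket (sbracket X Y) Z0) (sbracket (sbracket X Y) Z1) => S1 S2 S3 S4.
by rewrite scalerDr addrACA.
Qed.

Lemma osp_space_spart B p X : X \in osp_space B -> spart p X \in osp_space B.
Proof.
move=> /osp_space_defect X0; apply/osp_space_defect => q.
rewrite /preserve_defect spartK; case: eqP => [->|_]; first exact: X0.
by rewrite trmx0 mul0mx mulmx0 addr0.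
Qed.

Lemma sgnmxM p q : sgnmx p *m sgnmx q = sgnmx (p (+) q).
Proof.
rewrite /sgnmx mulmx_block !(mulmx0, mul0mx, addr0, add0r) mulmx1.
by rewrite -scalar_mxM signr_addb.
Qed.

Lemma sgnmx_tr p q X : shom p X ->
  X^T *m sgnmx q = (-1) ^+ (p && q) *: (sgnmx q *m X^T).
Proof.
move=> /eqP <-; rewrite /spart /sgnmx.
case: p; rewrite tr_block_mx !mulmx_block !trmx0
  !(mulmx0, mul0mx, addr0, add0r, mulmx1, mul1mx) !mul_mx_scalar mul_scalar_mx
  ?expr0 scale_block_mx !scaler0 ?scale1r //=.
by rewrite scalerA -signr_addb addbb scale1r.
Qed.

Lemma osp_space_hom B p X : shom p X -> X \in osp_space B ->
  X^T *m B = - (sgnmx p *m B *m X).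
Proof.
move=> Xp /osp_space_defect /(_ p); rewrite /preserve_defect.
by rewrite (spart_shom _ Xp) eqxx => /eqP; rewrite addr_eq0 => /eqP.
Qed.

Lemma osp_space_homI B p X : shom p X -> X^T *m B = - (sgnmx p *m B *m X) ->
  X \in osp_space B.
Proof.
move=> Xp XB; apply/osp_space_defect => q; rewrite /preserve_defect.
rewrite (spart_shom _ Xp); case: eqP => [->|_]; first by rewrite XB addNr.
by rewrite trmx0 mul0mx mulmx0 addr0.
Qed.

Lemma osp_space_br_hom B p q X Y : shom p X -> shom q Y ->
  X \in osp_space B -> Y \in osp_space B -> sbracket X Y \in osp_space B.
Proof.
move=> Xp Yq /(osp_space_hom Xp) XB /(osp_space_hom Yq) YB.
apply: (osp_space_homI (sbracket_hom Xp Yq)); rewrite (sbracket_shom Xp Yq).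
have trM p' q' X' Y' : shom p' X' -> shom q' Y' ->
    X'^T *m B = - (sgnmx p' *m B *m X') ->
    Y'^T *m B = - (sgnmx q' *m B *m Y') ->
    (X' *m Y')^T *m B
    = (-1) ^+ (p' && q') *: (sgnmx (p' (+) q') *m B *m (Y' *m X')).
  move=> X'p Y'q X'B Y'B; rewrite trmx_mul -[LHS]mulmxA X'B mulmxN !mulmxA.
  rewrite (sgnmx_tr _ Y'q) -!scalemxAl -[sgnmx p' *m _ *m B]mulmxA Y'B.
  by rewrite mulmxN mulNmx scalerN opprK !mulmxA sgnmxM andbC.
rewrite linearB linearZ /= mulmxBl -scalemxAl (trM _ _ _ _ Xp Yq XB YB).
rewrite (trM _ _ _ _ Yq Xp YB XB) andbC [q (+) p]addbC scalerA -signr_addb addbb.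
by rewrite scale1r mulmxBr -scalemxAr opprB.
Qed.

Lemma osp_space_br B X Y : X \in osp_space B -> Y \in osp_space B ->
  sbracket X Y \in osp_space B.
Proof.
move=> XB YB.
rewrite (spart_sum X) (spart_sum Y) sbracketDr !sbracketDl.
by apply: memvD; apply: memvD; apply: osp_space_br_hom (shom_spart _ _)
  (shom_spart _ _) _ _; apply: osp_space_spart.
Qed.

Section Osp.

Variable B : superform.
Local Notation V := (subvs_of (osp_space B)).
Implicit Types x y z : V.

Definition osp_br x y : V := Subvs (osp_space_br (subvsP x) (subvsP y)).

Lemma osp_br_bilinear : bilinear_for *:%R *:%R osp_br.
Proof.
by split=> [y a x x'|x a y y']; apply: val_inj;
  [apply: sbracket_bilinear.1 | apply: sbracket_bilinear.2].
Qed.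
HB.instance Definition _ :=
  bilinear_isBilinear.Build K V V V *:%R *:%R osp_br osp_br_bilinear.

Definition osp_part p : {vspace V} :=
  lker (linfun (spart (~~ p) \o vsval : V -> 'M[K]_(m + k))).

Lemma osp_partP p x : (x \in osp_part p) = shom p (vsval x).
Proof. by rewrite memv_ker lfunE /=; apply/eqP/shomP. Qed.

Lemma osp_part_full : (osp_part false + osp_part true = fullv)%VS.
Proof.
apply/vspaceP => x; rewrite memvf; apply/memv_addP.
exists (Subvs (osp_space_spart false (subvsP x))).
  by rewrite osp_partP shom_spart.
exists (Subvs (osp_space_spart true (subvsP x))).
  by rewrite osp_partP shom_spart.
by apply: val_inj; apply: spart_sum.
Qed.

Lemma osp_part_direct : (osp_part false :&: osp_part true = 0)%VS.
Proof.
apply/vspaceP => x; rewrite memv_cap memv0 !osp_partP.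
apply/andP/eqP => [[/shomP x1 /shomP x0]|->].
  by apply: val_inj; rewrite /= [vsval x]spart_sum x0 x1 addr0.
by split; apply/shomP; rewrite linear0.
Qed.

Lemma osp_br_part p q x y : x \in osp_part p -> y \in osp_part q ->
  osp_br x y \in osp_part (p (+) q).
Proof. by rewrite !osp_partP; apply: sbracket_hom. Qed.

Lemma osp_br_antisym p q x y : x \in osp_part p -> y \in osp_part q ->
  osp_br x y = - ((-1) ^+ (p && q) *: osp_br y x).
Proof.
by rewrite !osp_partP => xp yq; apply: val_inj; apply: sbracket_antisym.
Qed.

Lemma osp_br_jacobi p q x y z : x \in osp_part p -> y \in osp_part q ->
  osp_br x (osp_br y z)
  = osp_br (osp_br x y) z + (-1) ^+ (p && q) *: osp_br y (osp_br x z).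
Proof.
by rewrite !osp_partP => xp yq; apply: val_inj; apply: sbracket_jacobi.
Qed.

Definition osp : lieSuperalgebra K :=
  @LieSuperalgebra K V osp_part osp_br osp_part_full osp_part_direct
    osp_br_part osp_br_antisym osp_br_jacobi.

End Osp.

End Supermatrices.

(* Main.v *)
Require Import Defs.
From HB Require Import structures.
From mathcomp Require Import all_boot all_order all_algebra.
From mathcomp Require Import zify ring.

(* Over an algebraically closed field the form has a hyperbolic basis (v_i), and
   osp is spanned by the elements v_i ^ v_j, which are weight vectors for the
   diagonal torus.  As K is infinite of characteristic 5, some toral H
   has distinct nonzero eigenvalues on the root vectors.  Subtracting an inner
   derivation, one may assume that a derivation D kills H; then D is diagonal
   in the v_i ^ v_j, and brackets of odd root vectors force the eigenvalue at
   v_i ^ v_j to be z_i + z_j for a weight z, so that D is inner.  The invariant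
   supertrace form turns a 2-cocycle into a derivation, and inner derivations
   into coboundaries.  The argument works for all m > 0 and k > 0. *)

Set Implicit Arguments.
Unset Strict Implicit.
Unset Printing Implicit Defensive.

Import GRing.Theory.
Local Open Scope ring_scope.

(** Maps of both parities, and the duals of cocycles, are handled at once through [crossed]: the
    vanishing of H^1 and of H^2 both come down to the single statement [crossed_inner]. The prime
    field has too few elements to separate the roots, so the weights of H are values at a generic
    point of K; separation can only be asked up to the coincidences that hold identically, namely
    exchanging the two indices and w_i + w_(inv i) = 0. The invariant form is the supertrace of the
    defining representation and not the Killing form, which is, up to sign, m - k - 2 times it and
    so vanishes on osp(3|6) in characteristic 5. The spanning family is indexed by ordered pairs, so
    v_i ^ v_j and v_j ^ v_i both occur: hence the factors 1/2 and 4 below. *)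

Section CrossedDerivations.

Variables (K : fieldType) (g : lieSuperalgebra K).
Local Notation "[~ x , y ]" := (lsa_br g x y).

(* A sum of an even and an odd derivation satisfies this identity, in which the
   parity of [D] does not occur; so does the map dual to a 2-cocycle. *)
Definition crossed (D : 'End(g)) : Prop :=
  forall p q x y, x \in lsa_part g p -> y \in lsa_part g q ->
    D [~ x, y] = [~ D x, y] - (-1) ^+ (p && q) *: [~ D y, x].

Lemma crossedD D D' : crossed D -> crossed D' -> crossed (D + D').
Proof.
move=> cD cD' p q x y xp yq; rewrite !add_lfunE (cD p q) // (cD' p q) //.
by rewrite !linearDl scalerDr opprD addrACA.
Qed.

(** Turning [x, D y] into [D y, x] costs (-1)^(p(r+q)); together with the Leibniz sign (-1)^(rp)
    only (-1)^(pq) is left, and r has disappeared. *)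
Lemma homogeneous_derivation_crossed r D :
  homogeneous_derivation r D -> crossed D.
Proof.
case=> Dpart Dbr p q x y xp yq; rewrite (Dbr _ _ _ xp); congr (_ + _).
rewrite (lsa_br_antisym xp (Dpart _ _ yq)) scalerN scalerA; congr (- (_ *: _)).
by rewrite -signr_addb; case: p r q {Dpart Dbr xp yq} => [] [] [].
Qed.

Lemma derivation_crossed D : derivation D -> crossed D.
Proof.
case=> D0 [D1 [D0P D1P ->]].
by apply: crossedD; apply: homogeneous_derivation_crossed; eassumption.
Qed.

Lemma ad_crossed u : crossed (linfun (lsa_br g u)).
Proof.
by apply/derivation_crossed/inner_is_derivation; exists u => y; rewrite lfunE.
Qed.

End CrossedDerivations.

(** * Generic weights *)

Section GenericWeights.

Variables (I : finType) (inv : I -> I).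
Hypotheses (invK : involutive inv)
  (inv_fixed : forall i j, inv i = i -> inv j = j -> i = j).

(* Equality of the coefficients of X^x in W_i + W_j and W_k + W_l, where
   W_i = X^i - X^(inv i), with all terms moved to avoid subtraction. *)
Definition weight_count i j k l x : Prop :=
  ((i == x) + (j == x) + (inv k == x) + (inv l == x)
   = (inv i == x) + (inv j == x) + (k == x) + (l == x))%N.

(** This is the injectivity of j |-> W_j. For j not fixed, the coefficient of X^j decides; fixed
    points have W_j = 0, and there is at most one of them. *)
Lemma weight_count1 j l :
  (forall x, (j == x) + (inv l == x) = (inv j == x) + (l == x))%N -> j = l.
Proof.
move=> E; have := E j; have := E l; rewrite !eqxx.
case: (eqVneq j l) => // jl.
case: (eqVneq (inv j) j) => [jj|]; last by lia.
by case: (eqVneq (inv l) l) => [ll|]; [rewrite (inv_fixed jj ll)|lia].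
Qed.

Lemma weight_count_opp k l :
  (forall x, (inv k == x) + (inv l == x) = (k == x) + (l == x))%N -> l = inv k.
Proof.
move=> E; apply/esym/weight_count1 => x.
by rewrite E invK.
Qed.

(** Unless W_i + W_j = 0, a positive term on the left must be matched by k or l; cancelling it
    leaves the one-term case ([ik]). *)
Lemma weight_count2 i j k l : (forall x, weight_count i j k l x) ->
  [\/ j = inv i /\ l = inv k, i = k /\ j = l | i = l /\ j = k].
Proof.
rewrite /weight_count => E.
case: (eqVneq j (inv i)) => [ji|nji].
  constructor 1; split=> //; apply: weight_count_opp => x.
  by move: (E x); rewrite ji invK; lia.
have ik i' j' k' l' : i' = k' ->
    (forall x, weight_count i' j' k' l' x) -> j' = l'.
  rewrite /weight_count => -> E'; apply: weight_count1 => x.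
  by move: (E' x); lia.
(* A fixed i has W_i = 0 and leaves no trace, so j is matched instead; it is not fixed, since [inv]
   has at most one fixed point and j differs from inv i. *)
have [ii|nii] := eqVneq (inv i) i.
  have njj : inv j != j.
    by apply/eqP => jj; rewrite (inv_fixed ii jj) jj eqxx in nji.
  have := E j; rewrite !eqxx (negPf njj) ii.
  have [kj|nkj] := eqVneq k j.
    move=> _; subst; constructor 3; split=> //; apply: (ik j i j l) => // x.
    by move: (E x); rewrite /weight_count; lia.
  have [lj|nlj] := eqVneq l j; last by lia.
  move=> _; subst; constructor 2; split=> //; apply: (ik j i j k) => // x.
  by move: (E x); rewrite /weight_count; lia.
have := E i; rewrite !eqxx (negPf nii).
have -> : (inv j == i) = false.
  by apply/eqP => ji; rewrite -ji invK eqxx in nji.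
have [ki|nki] := eqVneq k i.
  move=> _; subst; constructor 2; split=> //; exact: (ik i j i l).
have [li|nli] := eqVneq l i; last by lia.
move=> _; subst; constructor 3; split=> //; apply: (ik i j i k) => // x.
by move: (E x); rewrite /weight_count; lia.
Qed.

(* The weights are the values at one point t of the polynomials
   X^i - X^(inv i), where t is not a root of any of the nonzero differences
   between sums of two of them; a coefficient of such a difference is an integer
   between -4 and 4, hence vanishes in characteristic 5 only if it is 0. *)
Lemma generic_weights (K : closedFieldType) : 5%N \in [pchar K] ->
  exists w : I -> K, (forall i, w (inv i) = - w i) /\
  (forall i j k l, w i + w j = w k + w l ->
     [\/ j = inv i /\ l = inv k, i = k /\ j = l | i = l /\ j = k]).
Proof.
move=> charK.
pose W i : {poly K} := 'X^(enum_rank i) - 'X^(enum_rank (inv i)).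
pose P (q : I * I * I * I) := W q.1.1.1 + W q.1.1.2 - (W q.1.2 + W q.2).
have coefW i x : (W i)`_(enum_rank x) = (i == x)%:R - (inv i == x)%:R.
  by rewrite coefB !coefXn !(inj_eq val_inj) !(inj_eq enum_rank_inj)
    ![x == _]eq_sym.
have P0 i j k l : P (i, j, k, l) = 0 ->
    [\/ j = inv i /\ l = inv k, i = k /\ j = l | i = l /\ j = k].
  move=> Pq; apply: weight_count2 => x.
  have /(congr1 (fun p : {poly K} => p`_(enum_rank x))) := Pq.
  rewrite /P /= coefB coefD (coefD (W k)) !coefW coef0.
  rewrite /weight_count.
  set a := (i == x); set b := (j == x); set c := (k == x); set d := (l == x).
  set a' := (inv i == x); set b' := (inv j == x); set c' := (inv k == x).
  set d' := (inv l == x) => E.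
  have {}E : (a + b + c' + d')%:R = (a' + b' + c + d)%:R :> K.
    apply/eqP; rewrite -subr_eq0; apply/eqP; rewrite -[RHS]E !natrD; ring.
  have /eqP := E; rewrite -subr_eq0 => /eqP {}E.
  (* Divisibility by 5 is read off the natural difference of the two counts, each at most 4, so the
     larger one has to be known. *)
  have [le|lt] := leqP (a' + b' + c + d) (a + b + c' + d').
    move: E; rewrite -natrB // => /eqP; rewrite -(dvdn_pcharf charK).
    by move: a b c d a' b' c' d' le => [] [] [] [] [] [] [] [].
  move: E => /eqP; rewrite -oppr_eq0 opprB -natrB ?(ltnW lt) //.
  rewrite -(dvdn_pcharf charK).
  by move: a b c d a' b' c' d' lt => [] [] [] [] [] [] [] [].
have /closed_nonrootP[t] : \prod_(q | P q != 0) P q != 0 by apply/prodf_neq0.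
rewrite rootE horner_prod => /prodf_neq0 nt.
exists (fun i => (W i).[t]); split=> [i|i j k l E].
  by rewrite -hornerN /W invK opprB.
apply: P0; apply/eqP; case: eqP => // /eqP Pq.
by have := nt _ Pq; rewrite /P /= hornerD hornerN !(hornerD (W _)) E subrr eqxx.
Qed.

End GenericWeights.

(** * Derivations in a weight basis *)

(* [ob_vec i j] stands for the operator
     x |-> v_i B(v_j, x) - (-1)^(p(i)p(j)) v_j B(v_i, x),
   where (v_i) is a homogeneous basis with B(v_i, v_j) <> 0 iff j = inv i.  The
   family spans but is redundant, by [ob_vec_sym]. *)
Record osp_basis (K : fieldType) (g : lieSuperalgebra K) (I : finType)
    (inv : I -> I) (par : I -> bool) := OspBasis {
  ob_form : I -> I -> K;
  ob_vec : I -> I -> g;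
  ob_coord : I -> I -> {scalar g};
  ob_invK : involutive inv;
  ob_inv_fixed : forall i j, inv i = i -> inv j = j -> i = j;
  ob_par_inv : forall i, par (inv i) = par i;
  ob_inv_odd : forall i, par i -> inv i != i;
  ob_form_neq0 : forall i j, (ob_form i j != 0) = (j == inv i);
  ob_form_sym : forall i j, ob_form j i = (-1) ^+ par i * ob_form i j;
  ob_vec_part : forall i j, ob_vec i j \in lsa_part g (par i (+) par j);
  ob_vec_sym : forall i j,
    ob_vec j i = - ((-1) ^+ (par i && par j) *: ob_vec i j);
  ob_vec_br : forall i j k l, lsa_br g (ob_vec i j) (ob_vec k l) =
    ob_form j k *: ob_vec i l
    - ((-1) ^+ (par i && par j) * ob_form i k) *: ob_vec j l
    + (-1) ^+ ((par i (+) par j) && par k) *: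
      (ob_form j l *: ob_vec k i
       - ((-1) ^+ (par i && par j) * ob_form i l) *: ob_vec k j);
  ob_expand : forall x, x = \sum_i \sum_j ob_coord i j x *: ob_vec i j;
  ob_coord_vec : forall k l i j, ob_coord k l (ob_vec i j) = 2%:R^-1 *
    (((i == k) && (j == l))%:R
     - (-1) ^+ (par i && par j) * ((i == l) && (j == k))%:R)
}.

Section OspBasis.

Variables (K : closedFieldType) (g : lieSuperalgebra K).
Variables (I : finType) (inv : I -> I) (par : I -> bool).
Variable ob : osp_basis g inv par.
Hypothesis charK : 5%N \in [pchar K].

Local Notation "[~ x , y ]" := (lsa_br g x y).
Local Notation b := (ob_form ob).
Local Notation f := (ob_vec ob).
Local Notation a := (ob_coord ob).
Let invK := ob_invK ob.
Let par_inv := ob_par_inv ob.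

Let two_neq0 : 2%:R != 0 :> K.
Proof. by rewrite -(dvdn_pcharf charK). Qed.

Lemma form_inv_neq0 i : b (inv i) i != 0.
Proof. by rewrite ob_form_neq0 invK. Qed.

Lemma form_eq0 i j : j != inv i -> b i j = 0.
Proof. by rewrite -(ob_form_neq0 ob) negbK => /eqP. Qed.

(** The factor 1/2 in [ob_coord_vec] shares each coefficient evenly between the two orders of a
    pair, so coordinates inherit the symmetry of the vectors. *)
Lemma coord_sym k l x : a l k x = - ((-1) ^+ (par k && par l) * a k l x).
Proof.
have coord_symf i j :
    a l k (f i j) = - ((-1) ^+ (par k && par l) * a k l (f i j)).
  rewrite !ob_coord_vec mulrCA -[RHS]mulrN; congr (_ * _).
  have [/andP[/eqP-> /eqP->]|_] := boolP ((i == k) && (j == l)).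
    by rewrite mulrBr mulrA -signr_addb addbb mul1r mulr1; ring.
  have [/andP[/eqP-> /eqP->]|_] := boolP ((i == l) && (j == k)).
    by rewrite mulrBr mulrA andbC -signr_addb addbb; ring.
  by rewrite !mulr0 subr0 mulr0 oppr0.
rewrite [x](ob_expand ob) !linear_sum /= mulr_sumr -sumrN.
apply: eq_bigr => i _; rewrite !linear_sum /= mulr_sumr -sumrN.
by apply: eq_bigr => j _; rewrite !linearZ /= coord_symf mulrN mulrCA.
Qed.

Lemma coord_inj x y : (forall i j, a i j x = a i j y) -> x = y.
Proof.
move=> xy; rewrite [x](ob_expand ob) [y](ob_expand ob).
by apply: eq_bigr => i _; apply: eq_bigr => j _; rewrite xy.
Qed.

(** These are the pairs with v_i ^ v_j nonzero: v_i ^ v_i vanishes for even i, but for odd i the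
    wedge is symmetric and v_i ^ v_i survives. *)
Definition nontrivial i j := (i != j) || par i.

Lemma coord_vec_neq0 i j : nontrivial i j -> a i j (f i j) != 0.
Proof.
rewrite /nontrivial ob_coord_vec !eqxx mulf_eq0 invr_eq0 (negPf two_neq0) /=.
case: eqVneq => [<-|nij] /=; last by rewrite mulr0 subr0 oner_eq0.
by move=> ->; rewrite mulr1 opprK; exact: two_neq0.
Qed.

Lemma vec_trivial i j : ~~ nontrivial i j -> f i j = 0.
Proof.
rewrite /nontrivial negb_or negbK => /andP[/eqP <- /negPf pi].
have := ob_vec_sym ob i i; rewrite pi scale1r => /eqP.
by rewrite -addr_eq0 -mulr2n -scaler_nat scaler_eq0 (negPf two_neq0) => /eqP.
Qed.

Lemma coord_vec_eq0 i j k l : ~ (i = k /\ j = l) -> ~ (i = l /\ j = k) ->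
  a k l (f i j) = 0.
Proof.
move=> n1 n2; rewrite ob_coord_vec.
have -> : (i == k) && (j == l) = false.
  by apply/negP => /andP[/eqP ? /eqP ?]; apply: n1.
have -> : (i == l) && (j == k) = false.
  by apply/negP => /andP[/eqP ? /eqP ?]; apply: n2.
by rewrite !mulr0 subr0 mulr0.
Qed.

(* The operator v_k |-> z_k v_k. *)
Definition toral (z : I -> K) : g :=
  \sum_i (z i / (2%:R * b (inv i) i)) *: f i (inv i).

Definition antisymmetric_weight (z : I -> K) := forall i, z (inv i) = - z i.

(** Two summands of [toral z] act on v_m, those at i = m and i = inv m; as z is antisymmetric each
    contributes z m / 2, whence the 2 in [toral]. *)
Lemma toral_br z k l : antisymmetric_weight z ->
  [~ toral z, f k l] = (z k + z l) *: f k l.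
Proof.
move=> zN; rewrite /toral linear_sumlz.
pose c i := z i / (2%:R * b (inv i) i).
have cE i : c i * b (inv i) i = z i / 2%:R.
  rewrite /c invfM mulrA mulfVK //; exact: form_inv_neq0.
have cE' i : c (inv i) * ((-1) ^+ par i * b (inv i) i) = - (z i / 2%:R).
  by rewrite /c invK zN (ob_form_sym ob (inv i) i) par_inv -mulNr invfM
    [X in X * _]mulrA mulfVK // mulf_eq0 signr_eq0 form_inv_neq0.
have sum1 (h : I -> g) m :
    \sum_i (c i * b (inv i) m) *: h i = (z m / 2%:R) *: h m.
  rewrite (bigD1 m) //= cE big1 ?addr0 // => i im.
  by rewrite form_eq0 ?mulr0 ?scale0r // invK eq_sym.
have sum2 (h : I -> g) m :
    \sum_i (c i * ((-1) ^+ par i * b i m)) *: h i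
    = - (z m / 2%:R) *: h (inv m).
  rewrite (bigD1 (inv m)) //= par_inv cE' big1 ?addr0 // => i im.
  rewrite form_eq0 ?mulr0 ?scale0r //.
  by apply: contraNneq im => ->; rewrite invK.
transitivity (\sum_i ((c i * b (inv i) k) *: f i l
    - (c i * ((-1) ^+ par i * b i k)) *: f (inv i) l
    + ((c i * b (inv i) l) *: f k i
       - (c i * ((-1) ^+ par i * b i l)) *: f k (inv i)))).
  apply: eq_bigr => i _; rewrite linearZl_LR ob_vec_br par_inv addbb andbb.
  by rewrite scale1r !(scalerDr, scalerN, scalerA).
rewrite !big_split /= !sumrN.
rewrite (sum1 (fun i => f i l)) (sum2 (fun i => f (inv i) l)).
rewrite (sum1 (fun i => f k i)) (sum2 (fun i => f k (inv i))) !invK.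
rewrite -!scalerBl -scalerDl; congr (_ *: _).
have half x : x / 2%:R - - (x / 2%:R) = x :> K.
  by rewrite opprK; field.
by rewrite !half.
Qed.

Lemma toral_part z : toral z \in lsa_part g false.
Proof.
apply: memv_suml => i _; apply: memvZ.
by rewrite -(addbb (par i)) -{2}par_inv ob_vec_part.
Qed.

Lemma br_toral z x : [~ x, toral z] = - [~ toral z, x].
Proof.
have /memv_addP[x0 x0P [x1 x1P ->]] :
    x \in (lsa_part g false + lsa_part g true)%VS.
  by rewrite lsa_part_full memvf.
rewrite linearDl linearDr (lsa_br_antisym x0P (toral_part z)).
by rewrite (lsa_br_antisym x1P (toral_part z)) !scale1r opprD.
Qed.

(** Symmetry of c makes rescaling compatible with the redundancy: f i j and f j i receive the same
    factor. *)
Lemma coord_sum (c : I -> I -> K) k l x : (forall i j, c i j = c j i) ->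
  a k l (\sum_i \sum_j (c i j * a i j x) *: f i j) = c k l * a k l x.
Proof.
move=> cC; rewrite [x in RHS](ob_expand ob) !linear_sum mulr_sumr /=.
apply: eq_bigr => i _; rewrite !linear_sum mulr_sumr /=.
apply: eq_bigr => j _; rewrite !linearZ /= -mulrA.
have [-> //|n1] := eqVneq (c i j) (c k l).
rewrite coord_vec_eq0 ?mulr0 // => -[ik jl].
  by rewrite ik jl eqxx in n1.
by rewrite ik jl cC eqxx in n1.
Qed.

Lemma coord_toral_br z i j x : antisymmetric_weight z ->
  a i j [~ toral z, x] = (z i + z j) * a i j x.
Proof.
move=> zN; rewrite -(coord_sum (c := fun i j => z i + z j)); last first.
  by move=> *; rewrite addrC.
rewrite [x in [~ _, x]](ob_expand ob) linear_sumr; congr (a i j _).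
apply: eq_bigr => k _; rewrite linear_sumr; apply: eq_bigr => l _.
by rewrite linearZr_LR toral_br //= scalerA mulrC.
Qed.

(** The weight inverts the coefficient in [toral]. It is antisymmetric because the signs from
    [coord_sym] and [ob_form_sym] combine to -1. *)
Lemma toralP x : (forall i j, j != inv i -> a i j x = 0) ->
  exists2 z, antisymmetric_weight z & x = toral z.
Proof.
move=> x0; exists (fun i => 2%:R * b (inv i) i * a i (inv i) x) => [i|].
  rewrite invK (ob_form_sym ob (inv i) i) par_inv (coord_sym i (inv i)).
  rewrite par_inv andbb; have := sqrr_sign K (par i).
  move: ((-1) ^+ par i) => s s2.
  by rewrite -[RHS]mulr1 -s2; ring.
rewrite [LHS](ob_expand ob) /toral; apply: eq_bigr => i _.
rewrite (bigD1 (inv i)) //= big1 ?addr0 => [|j ji]; last first.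
  by rewrite x0 ?scale0r.
congr (_ *: _); rewrite mulrAC mulfV ?mul1r //.
by rewrite mulf_eq0 (negPf two_neq0) form_inv_neq0.
Qed.

End OspBasis.

(** * Every crossed map is inner *)

Section CrossedInner.

Variables (K : closedFieldType) (g : lieSuperalgebra K).
Variables (I : finType) (inv : I -> I) (par : I -> bool).
Variable ob : osp_basis g inv par.
Hypothesis charK : 5%N \in [pchar K].
Variables i0 o0 : I.
Hypotheses (even_i0 : par i0 = false) (odd_o0 : par o0).

Local Notation "[~ x , y ]" := (lsa_br g x y).
Local Notation b := (ob_form ob).
Local Notation f := (ob_vec ob).
Local Notation a := (ob_coord ob).
Local Notation toral := (toral ob).
Local Notation antisymmetric_weight := (antisymmetric_weight inv).
Local Notation nontrivial := (nontrivial par).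
Let invK := ob_invK ob.
Let par_inv := ob_par_inv ob.

Let two_neq0 : 2%:R != 0 :> K.
Proof. by rewrite -(dvdn_pcharf charK). Qed.

(** This says that no nonzero element of the torus is central. An odd o forms a root with itself, so
    2 z o = 0; an even i forms one with [o0]. *)
Lemma weight_eq0 (z : I -> K) :
  (forall k l, l != inv k -> nontrivial k l -> z k + z l = 0) ->
  forall i, z i = 0.
Proof.
move=> z0.
have odd0 o : par o -> z o = 0.
  move=> po; apply/eqP; rewrite -(mulrI_eq0 _ (mulfI two_neq0)) mulr_natl.
  by rewrite mulr2n z0 // /nontrivial ?po ?orbT // eq_sym (ob_inv_odd ob).
move=> i; have [/odd0 //|pi] := boolP (par i).
have <- : z i + z o0 = z i by rewrite (odd0 o0) ?addr0.
rewrite z0 //; first by apply: contraNneq pi => oi; rewrite -par_inv -oi.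
by rewrite /nontrivial; apply/orP; left; apply: contraNneq pi => ->.
Qed.

Lemma toral0 z : (forall i, z i = 0) -> toral z = 0.
Proof. by move=> z0; apply: big1 => i _; rewrite z0 mul0r scale0r. Qed.

Variable w : I -> K.
Hypothesis wN : antisymmetric_weight w.
Hypothesis w_sep : forall i j k l, w i + w j = w k + w l ->
  [\/ j = inv i /\ l = inv k, i = k /\ j = l | i = l /\ j = k].

Lemma weight_neq0 i j : j != inv i -> w i + w j != 0.
Proof.
apply: contraNneq => wij; have : w i + w j = w i + w (inv i).
  by rewrite wij wN subrr.
by case/w_sep => [[->]|[_ ->]|[<- ->]].
Qed.

Section Commuting.

Variable D : 'End(g).
Hypothesis cD : crossed D.

Lemma crossed_toral z k l :
  D [~ toral z, f k l] = [~ D (toral z), f k l] + [~ toral z, D (f k l)].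
Proof.
rewrite (cD (toral_part ob z) (ob_vec_part ob k l)) scale1r.
by rewrite (br_toral ob) opprK.
Qed.

(** In the Leibniz rule for [toral w, f k l], the (k, l) coordinates of the two terms containing D
    (f k l) agree; so D (toral w), which lies in the torus, has eigenvalue 0 on every root
    vector. *)
Lemma crossed_kills_generic_toral :
  (forall i j, j != inv i -> a i j (D (toral w)) = 0) -> D (toral w) = 0.
Proof.
move=> /(toralP charK)[z zN DwE]; rewrite DwE; apply/toral0/weight_eq0.
move=> k l _ /(coord_vec_neq0 ob charK) akl.
have := crossed_toral w k l; rewrite DwE !toral_br // linearZ /=.
move=> /(congr1 (a k l)); rewrite linearD linearZ /= coord_toral_br //.
rewrite linearZ /= -[LHS]add0r => /addIr/esym/eqP.
by rewrite mulf_eq0 (negPf akl) orbF => /eqP.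
Qed.

Hypothesis Dw : D (toral w) = 0.

Lemma crossed_coord i j k l :
  (w k + w l) * a i j (D (f k l)) = (w i + w j) * a i j (D (f k l)).
Proof.
have := crossed_toral w k l; rewrite Dw linear0l add0r toral_br // linearZ /=.
by move=> /(congr1 (a i j)); rewrite linearZ /= coord_toral_br.
Qed.

Lemma crossed_coord_eq0 i j k l : w k + w l != w i + w j ->
  a i j (D (f k l)) = 0.
Proof.
move=> wn; have /eqP := crossed_coord i j k l.
by rewrite -subr_eq0 -mulrBl mulf_eq0 subr_eq0 (negPf wn) => /eqP.
Qed.

(** D commutes with ad (toral w), so it preserves the eigenspaces; by [w_sep] those for nonzero
    eigenvalues are lines. *)
Lemma crossed_root k l : l != inv k -> exists c, D (f k l) = c *: f k l.
Proof.
move=> lk.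
have [nt|/(vec_trivial ob charK) fkl0] := boolP (nontrivial k l); last first.
  by exists 0; rewrite fkl0 linear0 scaler0.
have akl := coord_vec_neq0 ob charK nt.
exists (a k l (D (f k l)) / a k l (f k l)).
apply: (coord_inj (ob := ob)) => i j; rewrite linearZ /=.
have [/eqP|wn] := boolP (w k + w l == w i + w j).
  case/w_sep => [[/eqP]|[<- <-]|[<- <-]]; first by rewrite (negPf lk).
    by rewrite mulfVK.
  by rewrite !(coord_sym ob k l) mulrN mulrCA mulfVK.
rewrite crossed_coord_eq0 //.
rewrite (@coord_vec_eq0 _ _ _ _ _ ob k l i j) ?mulr0 // => -[ki lj].
  by rewrite ki lj eqxx in wn.
by rewrite ki lj addrC eqxx in wn.
Qed.

(** D preserves the zero eigenspace, which is the torus. As D is diagonal on root vectors, the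
    Leibniz rule leaves [D t, f i j] = 0 for t in the torus. *)
Lemma crossed_toral_vec k : D (f k (inv k)) = 0.
Proof.
have [|z zN ->] := @toralP _ _ _ _ _ ob charK (f k (inv k)).
  move=> i j ji; rewrite coord_vec_eq0 // => -[ki kj].
    by rewrite -ki -kj eqxx in ji.
  by rewrite -ki -kj invK eqxx in ji.
have [|y yN DzE] := @toralP _ _ _ _ _ ob charK (D (toral z)).
  move=> i j ji; rewrite (linear_sum D) linear_sum big1 // => k' _.
  rewrite !linearZ /=.
  by rewrite crossed_coord_eq0 ?mulr0 // wN subrr eq_sym weight_neq0.
rewrite DzE; apply/toral0/weight_eq0 => i j ji nt.
have [c Dij] := crossed_root ji.
have := crossed_toral z i j.
rewrite DzE Dij linearZr_LR !toral_br // linearZ /= Dij scalerA mulrC -scalerA.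
rewrite -[LHS]add0r => /addIr/esym.
move=> /(congr1 (a i j)); rewrite linearZ linear0 => /eqP.
by rewrite mulf_eq0 (negPf (coord_vec_neq0 ob charK nt)) orbF => /eqP.
Qed.

(** The value 0 at l = inv k is the eigenvalue on the torus, by [crossed_toral_vec]. *)
Definition root_coef k l :=
  if l == inv k then 0 else a k l (D (f k l)) / a k l (f k l).
Local Notation c := root_coef.

Lemma root_coefE k l : D (f k l) = c k l *: f k l.
Proof.
rewrite /root_coef; case: eqVneq => [->|lk].
  by rewrite crossed_toral_vec scale0r.
have [nt|/(vec_trivial ob charK) ->] := boolP (nontrivial k l); last first.
  by rewrite linear0 scaler0.
have [e ->] := crossed_root lk.
by rewrite linearZ /= mulfK // (coord_vec_neq0 ob charK).
Qed.

Lemma root_coef_unique e k l : nontrivial k l ->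
  D (f k l) = e *: f k l -> c k l = e.
Proof.
move=> /(coord_vec_neq0 ob charK) akl; rewrite root_coefE.
by move=> /(congr1 (a k l)); rewrite !linearZ => /(mulIf akl).
Qed.

Lemma root_coef_inv k : c k (inv k) = 0.
Proof. by rewrite /root_coef eqxx. Qed.

Lemma root_coefC k l : nontrivial k l -> c k l = c l k.
Proof.
move=> nt; apply: root_coef_unique => //.
by rewrite (ob_vec_sym ob l k) linearN linearZ /= root_coefE scalerN
  !scalerA mulrC.
Qed.

Lemma root_coef_br i j k l :
  D [~ f i j, f k l] = (c i j + c k l) *: [~ f i j, f k l].
Proof.
have fp := ob_vec_part ob.
rewrite (cD (fp i j) (fp k l)) !root_coefE !linearZl_LR scalerDl /=.
congr (_ + _); rewrite (lsa_br_antisym (fp i j) (fp k l)).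
by rewrite !scalerN !scalerA mulrC.
Qed.

(** [v_i ^ v_q, v_(inv i) ^ v_r] is a nonzero multiple of v_q ^ v_r plus a toral term, invisible to
    the coordinate (q, r). The case r = inv q is included. *)
Lemma root_coef_odd i q r : par i = false -> par q -> par r ->
  c i q + c (inv i) r = c q r.
Proof.
move=> pi pq pr.
have ntqr : nontrivial q r by rewrite /nontrivial pq orbT.
have parN j k : par j != par k -> k != inv j.
  by apply: contraNneq => ->; rewrite par_inv.
have := root_coef_br i q (inv i) r.
rewrite (ob_vec_br ob) par_inv pi pq.
rewrite (form_eq0 ob (i := q)) ?parN ?par_inv ?pi ?pq //.
rewrite (form_eq0 ob (i := i) (j := r)) ?parN ?pi ?pr //.
rewrite !mulr0 !scale0r subr0 add0r !scale1r mul1r.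
rewrite linearD linearN !linearZ /= !root_coefE => /(congr1 (a q r)).
rewrite linearZ /= !linearD !linearN !linearZ /=.
rewrite (coord_vec_eq0 ob (i := inv i) (j := i)); first last.
- by case=> _ iq; rewrite -iq pi in pq.
- by case=> _ ir; rewrite -ir pi in pr.
rewrite !mulr0 !addr0 [X in _ = - X]mulrCA => /oppr_inj/esym.
have bii : b i (inv i) != 0 by rewrite ob_form_neq0.
by move/(mulfI bii)/(mulIf (coord_vec_neq0 ob charK ntqr)).
Qed.

(** Contracting the odd pair in [v_i ^ v_q, v_(inv q) ^ v_l] leaves a multiple of v_i ^ v_l only. *)
Lemma root_coef_even i l q : par i = false -> par l = false -> par q ->
  l != inv i -> nontrivial i l -> c i q + c (inv q) l = c i l.
Proof.
move=> pi pl pq li nt.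
have parN j k : par j != par k -> k != inv j.
  by apply: contraNneq => ->; rewrite par_inv.
have := root_coef_br i q (inv q) l.
rewrite (ob_vec_br ob) par_inv pi pq.
rewrite (form_eq0 ob (i := i) (j := inv q)) ?parN ?par_inv ?pi ?pq //.
rewrite (form_eq0 ob (i := q) (j := l)) ?parN ?pl ?pq //.
rewrite (form_eq0 ob (i := i) (j := l)) //.
rewrite !mulr0 !scale0r !subr0 scaler0 addr0 linearZ /= root_coefE.
move=> /(congr1 (a i l)); rewrite !linearZ /=.
have bqq : b q (inv q) != 0 by rewrite ob_form_neq0.
rewrite [RHS]mulrCA.
by move/(mulfI bqq)/(mulIf (coord_vec_neq0 ob charK nt))/esym.
Qed.

(** The formula is forced by c k l = z k + z l with z antisymmetric: c q q = 2 z q for odd q, and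
    for even q subtracting the values at q and inv q against [o0] eliminates z o0. *)
Definition root_weight q :=
  (if par q then c q q else c q o0 - c (inv q) o0) / 2%:R.
Local Notation z := root_weight.

(** [root_coef_odd] at (q, o0) and at (o0, q) yields the same value; equating the two expressions
    and using (q, q) gives 2 (z i + z q) = 2 c i q. *)
Lemma root_weight_even_odd i q : par i = false -> par q ->
  c i q = z i + z q.
Proof.
move=> pi pq; rewrite /root_weight pi pq.
have e1 := root_coef_odd pi pq pq.
have e2 := root_coef_odd pi pq odd_o0.
have := root_coef_odd pi odd_o0 pq.
rewrite (root_coefC (k := o0)); last by rewrite /nontrivial odd_o0 orbT.
rewrite -e2 -e1 => e3; have -> : c i q = c i o0 + c (inv i) q - c (inv i) o0.
  by rewrite e3 addrK.
by field.
Qed.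

(** For even q this is built into the definition; for odd q it is [root_coef_odd] at (q, inv q),
    where the coefficient is 0. *)
Lemma root_weightN : antisymmetric_weight z.
Proof.
move=> q; have [pq|/negPf pq] := boolP (par q); last first.
  by rewrite /root_weight par_inv pq invK -mulNr opprB.
have pi0 : par (inv i0) = false by rewrite par_inv.
have pq' : par (inv q) by rewrite par_inv.
have := root_coef_odd even_i0 pq pq'.
rewrite root_coef_inv !root_weight_even_odd // => e.
have zi0 : z (inv i0) = - z i0.
  by rewrite /root_weight par_inv even_i0 invK -mulNr opprB.
apply/eqP; rewrite -addr_eq0 -e zi0; apply/eqP; ring.
Qed.

Lemma root_weightE k l : nontrivial k l -> c k l = z k + z l.
Proof.
move=> nt; have zN := root_weightN.
have [pk|/negPf pk] := boolP (par k); have [pl|/negPf pl] := boolP (par l).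
- rewrite -(root_coef_odd even_i0 pk pl) !root_weight_even_odd ?par_inv //.
  by rewrite zN; ring.
- by rewrite root_coefC // addrC root_weight_even_odd.
- exact: root_weight_even_odd.
have [->|lk] := eqVneq l (inv k); first by rewrite root_coef_inv zN subrr.
have po' : par (inv o0) by rewrite par_inv.
rewrite -(root_coef_even pk pl odd_o0 lk nt).
rewrite (root_coefC (k := inv o0)) ?root_weight_even_odd //; last first.
  by rewrite /nontrivial po' orbT.
by rewrite zN; ring.
Qed.

Lemma crossed_commuting_inner : inner_derivation D.
Proof.
exists (toral z) => y; rewrite [y](ob_expand ob) linear_sumr linear_sum.
apply: eq_bigr => k _; rewrite linear_sumr linear_sum.
apply: eq_bigr => l _; rewrite linearZr_LR linearZ /=; congr (_ *: _).
rewrite toral_br //; last exact: root_weightN.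
have [nt|/(vec_trivial ob charK) ->] := boolP (nontrivial k l).
  by rewrite root_coefE root_weightE.
by rewrite linear0 scaler0.
Qed.

End Commuting.

Lemma crossed_commutes_generic D : crossed D ->
  exists u, (D + linfun (lsa_br g u)) (toral w) = 0.
Proof.
move=> cD; pose y := D (toral w).
(* u inverts ad (toral w) on the root part of y. At j = inv i the weight is 0, and so is its inverse
   by convention, so u has no toral part. *)
pose u := \sum_i \sum_j ((w i + w j)^-1 * a i j y) *: f i j.
exists u; apply: crossed_kills_generic_toral.
  by apply: crossedD => //; apply: ad_crossed.
move=> i j ji; rewrite add_lfunE lfunE /= (br_toral ob) linearB /=.
rewrite (coord_toral_br ob charK) //.
rewrite (coord_sum ob (c := fun i j => (w i + w j)^-1)) => [|k l].
  by rewrite mulVKf ?subrr // weight_neq0.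
by rewrite addrC.
Qed.

End CrossedInner.

Lemma crossed_inner (K : closedFieldType) (g : lieSuperalgebra K)
    (I : finType) (inv : I -> I) (par : I -> bool) (ob : osp_basis g inv par)
    (i0 o0 : I) (D : 'End(g)) :
  5%N \in [pchar K] -> par i0 = false -> par o0 -> crossed D ->
  inner_derivation D.
Proof.
move=> charK pi po cD.
have [w [wN w_sep]] := generic_weights (ob_invK ob) (ob_inv_fixed ob) charK.
have [u Du0] := crossed_commutes_generic ob charK po wN w_sep cD.
have [|v Dv] := crossed_commuting_inner charK pi po wN w_sep _ Du0.
  by apply: crossedD => //; apply: ad_crossed.
exists (v - u) => y.
by rewrite linearBl /= -Dv add_lfunE lfunE /= addrK.
Qed.

(** * Second cohomology from an invariant form *)

Section InvariantForm.

Variables (K : closedFieldType) (g : lieSuperalgebra K).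
Variables (I : finType) (inv : I -> I) (par : I -> bool).
Variable ob : osp_basis g inv par.
Variable kappa : {bilinear g -> g -> K | *%R & *%R}.
Variable scale : I -> I -> K.

Local Notation "[~ x , y ]" := (lsa_br g x y).
Local Notation f := (ob_vec ob).
Local Notation a := (ob_coord ob).

Hypothesis kappa_br : forall x y z, kappa [~ x, y] z = kappa x [~ y, z].
Hypothesis scaleC : forall i j, scale i j = scale j i.
Hypothesis scale_neq0 : forall i j, scale i j != 0.
Hypothesis kappa_vec : forall x k l,
  kappa x (f k l) = scale k l * a (inv l) (inv k) x.

Lemma kappa_inj x y : (forall z, kappa x z = kappa y z) -> x = y.
Proof.
move=> xy; apply: (coord_inj (ob := ob)) => i j.
have := xy (f (inv j) (inv i)); rewrite !kappa_vec !(ob_invK ob).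
by move/(mulfI (scale_neq0 _ _)).
Qed.

(** This is [coord_sum] at f k l with the matrix of coordinates transposed; that matrix is
    symmetric. *)
Lemma vec_expand_scale (c : I -> I -> K) k l : (forall i j, c i j = c j i) ->
  \sum_i \sum_j (c i j * a k l (f i j)) *: f i j = c k l *: f k l.
Proof.
move=> cC; apply: (coord_inj (ob := ob)) => i j.
transitivity (c i j * a i j (f k l)); last first.
  rewrite linearZ /=; have [-> //|cn] := eqVneq (c i j) (c k l).
  rewrite coord_vec_eq0 ?mulr0 // => -[ki lj].
    by rewrite ki lj eqxx in cn.
  by rewrite ki lj cC eqxx in cn.
rewrite -(coord_sum ob) //; congr (a i j _).
apply: eq_bigr => i' _; apply: eq_bigr => j' _; congr ((_ * _) *: _).
rewrite !ob_coord_vec ![k == _]eq_sym ![l == _]eq_sym.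
have [/andP[/eqP-> /eqP->]|/negPf n2] := boolP ((i' == l) && (j' == k)).
  by rewrite !eqxx [par l && _]andbC.
by rewrite [(j' == k) && _]andbC n2 !mulr0.
Qed.

Section Dual.

Variable w : {bilinear g -> g -> K | *%R & *%R}.

(** By [kappa_vec] the family dual to f i j for [kappa] is f (inv j) (inv i) up to the scale, so
    this is the element representing the functional [w x]. *)
Definition dual_map x : g :=
  \sum_i \sum_j ((scale i j)^-1 * w x (f i j)) *: f (inv j) (inv i).

Lemma dual_map_linear : linear dual_map.
Proof.
move=> t x y; rewrite /dual_map scaler_sumr -big_split; apply: eq_bigr => i _.
rewrite scaler_sumr -big_split; apply: eq_bigr => j _ /=.
by rewrite linearPl scalerA -scalerDl mulrDr mulrCA.
Qed.
HB.instance Definition _ :=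
  GRing.isLinear.Build K g g *:%R dual_map dual_map_linear.

Lemma kappa_dual_map x y : kappa (dual_map x) y = w x y.
Proof.
rewrite [y](ob_expand ob) !linear_sumr; apply: eq_bigr => k _.
rewrite !linear_sumr; apply: eq_bigr => l _.
rewrite !linearZr_LR /= kappa_vec; congr (_ * _).
rewrite -[RHS](mulVKf (scale_neq0 k l)); congr (_ * _).
rewrite -[RHS](linearZr_LR w).
rewrite -(vec_expand_scale (c := fun i j => (scale i j)^-1)); last first.
  by move=> i j; rewrite scaleC.
rewrite /dual_map !linear_sum /=; apply: eq_bigr => i _.
rewrite !linear_sum /=; apply: eq_bigr => j _.
rewrite linearZ linearZr_LR /= mulrAC; congr (_ * _ * _).
rewrite !ob_coord_vec !(ob_par_inv ob) !(inj_eq (inv_inj (ob_invK ob))).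
by rewrite andbC [par j && _]andbC [(j == k) && _]andbC.
Qed.

(** After moving the brackets to the left argument by invariance, the cocycle identity is the
    crossed identity paired with z. *)
Lemma dual_map_crossed : cocycle2 w -> crossed (linfun dual_map).
Proof.
case=> _ w_br p q x y xp yq; rewrite !lfunE /=; apply: kappa_inj => z.
rewrite kappa_dual_map (w_br _ _ _ _ _ xp yq) linearBl linearZl_LR /=.
by rewrite !kappa_br !kappa_dual_map.
Qed.

End Dual.

(** If the dual map is ad u, then w x y = kappa [u, x] y = kappa u [x, y], the coboundary of
    [kappa u]. *)
Lemma H2_eq0_crossed : (forall D : 'End(g), crossed D -> inner_derivation D) ->
  H2_trivial_eq0 g.
Proof.
move=> inner w /dual_map_crossed/inner[u Du]; exists (kappa u) => x y.
by rewrite /= -kappa_br -Du lfunE /= kappa_dual_map.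
Qed.

End InvariantForm.

(** * Hyperbolic bases *)

Lemma mx11_tr (K : nzRingType) (A : 'M[K]_1) : A^T 0 0 = A 0 0.
Proof. by rewrite mxE. Qed.

Section GramForm.

Variables (K : fieldType) (n : nat) (G : 'M[K]_n).

Definition gram_form (u v : 'cV[K]_n) : K := (u^T *m G *m v) 0 0.

Lemma gram_form_bilinear : bilinear_for *%R *%R gram_form.
Proof.
split=> [v t u u'|u t v v']; rewrite /gram_form /=.
  by rewrite linearP !mulmxDl -!scalemxAl !mxE.
by rewrite mulmxDr -scalemxAr !mxE.
Qed.
HB.instance Definition _ := bilinear_isBilinear.Build K
  'cV[K]_n 'cV[K]_n K *%R *%R gram_form gram_form_bilinear.

Lemma gram_form_sym (s : bool) : G^T = (-1) ^+ s *: G ->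
  forall u v, gram_form v u = (-1) ^+ s * gram_form u v.
Proof.
move=> Gs u v; rewrite /gram_form -[LHS]mx11_tr.
by rewrite !trmx_mul trmxK Gs -scalemxAl -scalemxAr mulmxA [LHS]mxE.
Qed.

Lemma gram_form_nondegenerate : G \in unitmx ->
  forall u, (forall v, gram_form u v = 0) -> u = 0.
Proof.
move=> Gu u u0; apply: (can_inj trmxK); rewrite trmx0.
apply: (can_inj (mulmxK Gu)); rewrite mul0mx; apply/rowP => j.
have := u0 (delta_mx j 0); rewrite /gram_form -colE mxE => ->.
by rewrite mxE.
Qed.

End GramForm.

Section HyperbolicBasis.

Variables (K : closedFieldType) (n : nat) (G : 'M[K]_n) (s : bool).
Hypothesis two_neq0 : 2%:R != 0 :> K.
Hypothesis G_sym : G^T = (-1) ^+ s *: G.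

Local Notation B := (gram_form G).
Let symB := gram_form_sym G_sym.

Implicit Types (U : {vspace 'cV[K]_n}) (u v x : 'cV[K]_n).

Definition nondegenerate_on U :=
  forall u, u \in U -> (forall v, v \in U -> B u v = 0) -> u = 0.

Definition gram_functional u : 'cV[K]_n -> K^o := B u.

Lemma gram_functional_linear u : linear (gram_functional u).
Proof. by move=> t v v'; rewrite /gram_functional linearPr. Qed.
HB.instance Definition _ u := GRing.isLinear.Build K 'cV[K]_n K^o *:%R
  (gram_functional u) (gram_functional_linear u).

Definition gram_perp u := linfun (gram_functional u).

Lemma mem_gram_perp u v : (v \in lker (gram_perp u)) = (B u v == 0).
Proof. by rewrite memv_ker /gram_perp lfunE. Qed.

Lemma dim_cap_perp U u v : v \in U -> B u v != 0 ->
  (\dim U).-1 = \dim (U :&: lker (gram_perp u)).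
Proof.
move=> vU Buv; have := limg_ker_dim (gram_perp u) U.
have : \dim (gram_perp u @: U) = 1%N.
  apply/eqP; rewrite eqn_leq; apply/andP; split.
    by rewrite (leq_trans (dimvS (subvf _))) // dimvf.
  rewrite lt0n dimv_eq0; apply: contraNneq Buv => im0.
  by have := memv_img (gram_perp u) vU; rewrite im0 memv0 /gram_perp lfunE.
by move=> -> <-; rewrite addn1.
Qed.

(** On a plane spanned by x and y, with y anisotropic, B (x + t y) (x + t y) is a quadratic
    polynomial in t and has a root. *)
Lemma isotropic_vector U : (1 < \dim U)%N ->
  exists u, [/\ u \in U, u != 0 & B u u = 0].
Proof.
move=> dU; have U0 : U != 0%VS by rewrite -dimv_eq0 -lt0n ltnW.
pose x := vpick U; have xU : x \in U := memv_pick U.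
have x0 : x != 0 by rewrite vpick0.
have /subvPn[y yU yx] : ~~ (U <= <[x]>)%VS.
  by apply: contraL dU => /dimvS; rewrite dim_vline x0 -leqNgt.
have [By0|By0] := eqVneq (B y y) 0.
  exists y; split=> //; apply: contraNneq yx => ->; exact: mem0v.
pose p : {poly K} :=
  (B y y)%:P * 'X^2 + (B x y + B y x)%:P * 'X + (B x x)%:P.
have p2 : p`_2 = B y y.
  by rewrite /p !coefD !coefCM coefXn coefX coefC /= mulr1 mulr0 !addr0.
have /closed_rootP[t] : size p != 1%N.
  by apply: contraNneq By0 => sp; rewrite -p2 nth_default ?sp.
rewrite rootE !(hornerD, hornerCM, hornerXn, hornerX, hornerC) => /eqP pt.
exists (x + t *: y); split.
- by rewrite memvD // memvZ.
- apply: contraNneq yx => xty; have [t0|t0] := eqVneq t 0.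
    by move: x0; rewrite -xty t0 scale0r addr0 eqxx.
  have -> : y = - t^-1 *: x.
    move/eqP: xty; rewrite addr_eq0 => /eqP ->.
    by rewrite scalerN scaleNr opprK scalerA mulVf ?scale1r.
  by rewrite memvZ ?memv_line.
by rewrite linearDl !linearDr !linearZl_LR !linearZr_LR /= -[RHS]pt; ring.
Qed.

Lemma hyperbolic_pair U : nondegenerate_on U -> (1 < \dim U)%N ->
  exists u v, [/\ u \in U, v \in U, B u u = 0, B v v = 0 & B u v = 1].
Proof.
move=> Und /isotropic_vector[u [uU u0 Buu]].
have /subvPn[v0 v0U] : ~~ (U <= lker (gram_perp u))%VS.
  apply: contraNN u0 => /subvP uperp; apply/eqP/Und => // v /uperp.
  by rewrite mem_gram_perp => /eqP.
rewrite mem_gram_perp => Buv0; pose v1 := (B u v0)^-1 *: v0.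
have v1U : v1 \in U by rewrite memvZ.
have Buv1 : B u v1 = 1 by rewrite linearZr_LR /= mulVf.
move: v1 v1U Buv1 => {v0 v0U Buv0} v1 v1U Buv1.
(* Subtracting c u lowers B v1 v1 by 2 c in the symmetric case; in the antisymmetric case B v1 v1 is
   already 0. *)
exists u, (v1 - (B v1 v1 / 2%:R) *: u); split=> //.
- by rewrite memvB // memvZ.
- rewrite linearBl !linearBr !linearZl_LR !linearZr_LR /= Buu Buv1.
  have := symB u v1; rewrite Buv1 mulr1 => ->.
  have := symB v1 v1; case: s => /=; last by move=> _; field.
  rewrite expr1 mulN1r => Bv1.
  have /eqP : 2%:R * B v1 v1 = 0 by rewrite mulr_natl mulr2n {1}Bv1 addNr.
  by rewrite mulf_eq0 (negPf two_neq0) => /eqP ->; rewrite !mul0r !subr0.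
by rewrite linearBr linearZr_LR /= Buu mulr0 subr0.
Qed.

(** Induction splits off hyperbolic planes, down to dimension 0 or 1; the Gram matrix becomes
    antidiagonal. The last clause, separation of points, stands in for the basis property. *)
Lemma hyperbolic_sequence d U : \dim U = d -> nondegenerate_on U ->
  exists e : nat -> 'cV[K]_n,
  [/\ forall i, (i < d)%N -> e i \in U,
      forall i j, (i < d)%N -> (j < d)%N ->
        (B (e i) (e j) != 0) = (i + j.+1 == d)
    & forall x, x \in U -> (forall i, (i < d)%N -> B (e i) x = 0) -> x = 0].
Proof.
have [N] := ubnP d; elim: N d U => // N IH [|[|d]] U dN dU Und.
- exists (fun=> 0); split=> // x; move/eqP: dU; rewrite dimv_eq0 => /eqP ->.
  by rewrite memv0 => /eqP.
- have U0 : U != 0%VS by rewrite -dimv_eq0 dU.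
  pose x := vpick U; have x0 : x != 0 by rewrite vpick0.
  have UE : U = <[x]>%VS.
    apply/eqP; rewrite eq_sym eqEdim dim_vline x0 dU leqnn andbT.
    exact: memv_pick.
  have Bx : B x x != 0.
    apply: contraNneq x0 => Bx0; apply/eqP/Und => [|v].
      exact: memv_pick.
    by rewrite UE => /vlineP[c ->]; rewrite linearZr_LR /= Bx0 mulr0.
  exists (fun=> x); split=> [i _|[|i] [|j] //|y]; first exact: memv_pick.
  rewrite UE => /vlineP[c ->] /(_ 0%N isT) /eqP.
  rewrite linearZr_LR /= mulf_eq0 (negPf Bx) orbF => /eqP ->.
  by rewrite scale0r.
have [|u [v [uU vU Buu Bvv Buv]]] := hyperbolic_pair Und; first by rewrite dU.
have Bvu : B v u = (-1) ^+ s by rewrite (symB u v) Buv mulr1.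
pose U1 := (U :&: lker (gram_perp u))%VS.
pose U2 := (U1 :&: lker (gram_perp v))%VS.
have U2P x : (x \in U2) = [&& x \in U, B u x == 0 & B v x == 0].
  by rewrite !memv_cap !mem_gram_perp andbA.
have dU2 : \dim U2 = d.
  have uU1 : u \in U1 by rewrite memv_cap uU mem_gram_perp Buu eqxx.
  rewrite -(dim_cap_perp uU1) ?Bvu ?signr_eq0 //.
  by rewrite -(dim_cap_perp vU) ?Buv ?oner_eq0 // dU.
have U2nd : nondegenerate_on U2.
  move=> x; rewrite U2P => /and3P[xU /eqP Bux /eqP Bvx] x0.
  apply: Und => // y yU.
  (* The projection of y along the plane of u and v; the sign is B v u, its own inverse. *)
  pose z := y - B u y *: v - ((-1) ^+ s * B v y) *: u.
  have zU2 : z \in U2.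
    rewrite U2P /z !memvB ?memvZ //= !linearBr !linearZr_LR /= Buu Bvv Buv Bvu.
    rewrite !mulr0 mulr1 subr0 subrr eqxx /= mulrAC -signr_addb addbb mul1r.
    by rewrite subr0 subrr.
  have yE : y = z + ((-1) ^+ s * B v y) *: u + B u y *: v by rewrite !subrK.
  move: z zU2 yE => z zU2 yE; rewrite yE !linearDr !linearZr_LR /=.
  rewrite (x0 _ zU2) (symB u x) (symB v x) Bux Bvx.
  by rewrite !mulr0 !addr0.
have [|e [eU eB e0]] := IH _ _ _ dU2 U2nd; first by rewrite ltnW.
(* Placing u first and v last keeps the pairing of the form i with d - 1 - i, that is [rev_ord]. *)
pose e' i := if i == 0%N then u else if i == d.+1 then v else e i.-1.
have mid i : (i < d.+2)%N -> i != 0%N -> i != d.+1 -> (i.-1 < d)%N by lia.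
exists e'; split=> [i id|i j id jd|x xU x0].
- rewrite /e'; case: eqVneq => // i0; case: eqVneq => // i1.
  by have := eU _ (mid _ id i0 i1); rewrite U2P => /andP[].
- have Bue k : (k < d)%N -> B u (e k) = 0.
    by move=> /eU; rewrite U2P => /and3P[_ /eqP].
  have Bve k : (k < d)%N -> B v (e k) = 0.
    by move=> /eU; rewrite U2P => /and3P[_ _ /eqP].
  have Beu k : (k < d)%N -> B (e k) u = 0.
    by move=> kd; rewrite (symB u) Bue ?mulr0.
  have Bev k : (k < d)%N -> B (e k) v = 0.
    by move=> kd; rewrite (symB v) Bve ?mulr0.
  rewrite /e'; case: (eqVneq i 0%N) => [->|i0].
    case: (eqVneq j 0%N) => [->|j0]; first by rewrite Buu eqxx.
    case: (eqVneq j d.+1) => [->|j1]; first by rewrite Buv oner_eq0 eqxx.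
    by rewrite Bue ?mid // eqxx; lia.
  case: (eqVneq i d.+1) => [->|i1].
    case: (eqVneq j 0%N) => [->|j0]; first by rewrite Bvu signr_eq0; lia.
    case: (eqVneq j d.+1) => [->|j1]; first by rewrite Bvv eqxx; lia.
    by rewrite Bve ?mid // eqxx; lia.
  case: (eqVneq j 0%N) => [->|j0]; first by rewrite Beu ?mid // eqxx; lia.
  case: (eqVneq j d.+1) => [->|j1]; first by rewrite Bev ?mid // eqxx; lia.
  by rewrite eB ?mid //; lia.
apply: e0 => [|i id].
  have /eqP := x0 0%N isT; have /eqP := x0 d.+1 (ltnSn _).
  by rewrite U2P xU /e' /= eqxx => -> ->.
have := x0 i.+1; rewrite /e' /= eqSS (ltn_eqF id) => -> //.
by rewrite ltnS ltnW.
Qed.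

Lemma hyperbolic_basis : G \in unitmx ->
  exists e : 'I_n -> 'cV[K]_n,
    (forall i j, (B (e i) (e j) != 0) = (j == rev_ord i)) /\
    (forall x, (forall i, B (e i) x = 0) -> x = 0).
Proof.
move=> Gu; have [||e [_ eB e0]] := @hyperbolic_sequence n fullv.
- by rewrite dimvf /dim /= muln1.
- move=> u _ u0; apply: (gram_form_nondegenerate Gu) => v.
  by rewrite u0 ?memvf.
exists (fun i => e i); split=> [i j|x x0].
  by rewrite eB // -val_eqE /=; have := ltn_ord i; have := ltn_ord j; lia.
by apply: e0 => [|i id]; [exact: memvf|exact: (x0 (Ordinal id))].
Qed.

End HyperbolicBasis.

(** * The weight basis of osp *)

Section OspBasisOfForm.

Variables (K : closedFieldType) (m k : nat) (B : superform K m k).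
Hypothesis two_neq0 : 2%:R != 0 :> K.

Local Notation sgn := (sgnmx K m k true).
Implicit Types X Y Z : 'M[K]_(m + k).

Lemma eq_oppmx p q (A : 'M[K]_(p, q)) : A = - A -> A = 0.
Proof.
move/eqP; rewrite -addr_eq0 -mulr2n -scaler_nat scaler_eq0 (negPf two_neq0).
by move/eqP.
Qed.

(** Parity becomes commuting or anticommuting with the grading operator: the wrong blocks equal
    their own opposites, hence vanish. Later sign computations need no blocks. *)
Lemma shom_sgnP p X : shom p X <-> sgn *m X = (-1) ^+ p *: (X *m sgn).
Proof.
rewrite -[X]submxK; move: (ulsubmx X) (ursubmx X) (dlsubmx X) (drsubmx X).
move=> X1 X2 X3 X4; rewrite /shom /spart /sgnmx !mulmx_block expr1.
rewrite !(mul0mx, mulmx0, add0r, addr0, mul1mx, mulmx1, mul_scalar_mx).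
rewrite !mul_mx_scalar !scaleN1r scale_block_mx.
rewrite !(block_mxKul, block_mxKur, block_mxKdl, block_mxKdr).
case: p; rewrite ?expr0 ?expr1 ?scale1r ?scaleN1r ?opprK.
  split=> [/eqP/eq_block_mx[<- _ _ <-]|/eq_block_mx[/eq_oppmx-> _ _]].
    by rewrite !oppr0.
  by move/esym/eq_oppmx->.
split=> [/eqP/eq_block_mx[_ <- <- _]|/eq_block_mx[_ /eq_oppmx-> /esym]].
  by rewrite !oppr0.
by move/eq_oppmx->.
Qed.

Lemma gram_sgn : sgn *m B = B *m sgn.
Proof.
have [B12 B21] := gram_even B; rewrite -[gram B]submxK B12 B21 /sgnmx.
rewrite !mulmx_block !(mul0mx, mulmx0, add0r, addr0, mul1mx, mulmx1).
by rewrite mul_scalar_mx mul_mx_scalar.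
Qed.

Lemma gram_tr : B^T = sgn *m B.
Proof.
have [B12 B21] := gram_even B.
rewrite -[in LHS](submxK B) -[in RHS](submxK B) B12 B21 /sgnmx.
rewrite tr_block_mx gram_sym gram_antisym !trmx0 !mulmx_block.
rewrite !(mul0mx, mulmx0, add0r, addr0, mul1mx, mulmx1).
by rewrite mul_scalar_mx expr1 scaleN1r.
Qed.

Lemma mxtrace_sgn_odd X : shom true X -> \tr (sgn *m X) = 0.
Proof.
move/eqP <-; rewrite /sgnmx /spart mulmx_block mxtrace_block.
by rewrite !(mul0mx, mulmx0, addr0, add0r) !mxtrace0 addr0.
Qed.

(** Moving Y cyclically past [sgn] costs (-1)^q. This matches the signs of the two brackets when p =
    q + r; otherwise Y X Z is odd and has supertrace 0. *)
Lemma str_invariant_hom p q r X Y Z : shom p X -> shom q Y -> shom r Z ->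
  \tr (sgn *m sbracket X Y *m Z) = \tr (sgn *m X *m sbracket Y Z).
Proof.
move=> Xp Yq Zr; rewrite (sbracket_shom Xp Yq) (sbracket_shom Yq Zr).
rewrite mulmxBr mulmxBl (mulmxBr _ (Y *m Z)) !linearB /=.
rewrite -!scalemxAr -!scalemxAl !linearZ /=.
rewrite !mulmxA; congr (_ - _).
have -> : \tr (sgn *m X *m Z *m Y) = (-1) ^+ q * \tr (sgn *m Y *m X *m Z).
  move/shom_sgnP: Yq => ->; rewrite mxtrace_mulC !mulmxA.
  by rewrite -!scalemxAl linearZ /= mulrA -signr_addb addbb mul1r.
have [/eqP ptr|ptr] := boolP (p == q (+) r).
  rewrite mulrA -signr_addb ptr; congr ((-1) ^+ _ * _).
  by case: q r {Yq Zr ptr} => [] [].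
have odd_YXZ : shom true (Y *m X *m Z).
  have -> : true = q (+) p (+) r by case: p q r ptr {Xp Yq Zr} => [] [] [].
  exact: shomM (shomM Yq Xp) Zr.
have -> : \tr (sgn *m Y *m X *m Z) = 0.
  by rewrite -!mulmxA [Y *m _]mulmxA mxtrace_sgn_odd.
by rewrite !mulr0.
Qed.

Lemma str_invariant X Y Z :
  \tr (sgn *m sbracket X Y *m Z) = \tr (sgn *m X *m sbracket Y Z).
Proof.
have [X0 X1] := (shom_spart false X, shom_spart true X).
have [Y0 Y1] := (shom_spart false Y, shom_spart true Y).
have [Z0 Z1] := (shom_spart false Z, shom_spart true Z).
rewrite (spart_sum X) (spart_sum Y) (spart_sum Z).
move: (spart false X) (spart true X) X0 X1 => {}X X' hX hX'.
move: (spart false Y) (spart true Y) Y0 Y1 => {}Y Y' hY hY'.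
move: (spart false Z) (spart true Z) Z0 Z1 => {}Z Z' hZ hZ'.
move: (@sbracketDl K m k) (@sbracketDr K m k) str_invariant_hom.
move: (@sbracket K m k) => br brDl brDr str_hom.
rewrite !(brDl, brDr) !(mulmxDr, mulmxDl) !mxtraceD.
rewrite (str_hom _ _ _ _ _ _ hX hY hZ) (str_hom _ _ _ _ _ _ hX hY hZ').
rewrite (str_hom _ _ _ _ _ _ hX hY' hZ) (str_hom _ _ _ _ _ _ hX hY' hZ').
rewrite (str_hom _ _ _ _ _ _ hX' hY hZ) (str_hom _ _ _ _ _ _ hX' hY hZ').
rewrite (str_hom _ _ _ _ _ _ hX' hY' hZ) (str_hom _ _ _ _ _ _ hX' hY' hZ').
ring.
Qed.

Local Notation V := (osp B).

Lemma osp_vsvalP t (x y : V) : vsval (t *: x + y) = t *: vsval x + vsval y.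
Proof. exact: linearP. Qed.

Definition supertrace_form (x y : V) : K := \tr (sgn *m vsval x *m vsval y).

Lemma supertrace_form_bilinear : bilinear_for *%R *%R supertrace_form.
Proof.
split=> [y t x x'|x t y y']; rewrite /supertrace_form osp_vsvalP.
  by rewrite mulmxDr mulmxDl -scalemxAr -scalemxAl linearP.
by rewrite mulmxDr -scalemxAr linearP.
Qed.
HB.instance Definition _ := bilinear_isBilinear.Build K
  V V K *%R *%R supertrace_form supertrace_form_bilinear.

Lemma supertrace_form_br x y z :
  supertrace_form (lsa_br V x y) z = supertrace_form x (lsa_br V y z).
Proof. exact: str_invariant. Qed.

Variables (I : finType) (inv : I -> I) (par : I -> bool).
Variable v : I -> 'cV[K]_(m + k).
Hypotheses (invK : involutive inv)
  (inv_fixed : forall i j, inv i = i -> inv j = j -> i = j)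
  (par_inv : forall i, par (inv i) = par i)
  (inv_odd : forall i, par i -> inv i != i).
Hypothesis v_form_neq0 :
  forall i j, (form_eval B (v i) (v j) != 0) = (j == inv i).
Hypothesis v_par : forall i, sgn *m v i = (-1) ^+ par i *: v i.
Hypothesis v_inj : forall q (Y : 'M[K]_(m + k, q)),
  (forall i, (v i)^T *m Y = 0) -> Y = 0.

Local Notation b i j := (form_eval B (v i) (v j)).

Lemma v_tr_par i : (v i)^T *m sgn = (-1) ^+ par i *: (v i)^T.
Proof.
apply: trmx_inj; rewrite trmx_mul trmxK linearZ /= trmxK -v_par.
by rewrite /sgnmx tr_block_mx !trmx0 trmx1 tr_scalar_mx.
Qed.

Definition coef i j X : K := ((v i)^T *m B *m X *m v j) 0 0.

Lemma coef_linear i j : scalar (coef i j).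
Proof.
move=> t X Y; rewrite /coef mulmxDr mulmxDl -scalemxAr -scalemxAl mxE.
by rewrite [X in X + _]mxE.
Qed.
HB.instance Definition _ i j := GRing.isLinear.Build K 'M[K]_(m + k) K *%R
  (coef i j) (coef_linear i j).

Lemma coef_inj X Y : (forall i j, coef i j X = coef i j Y) -> X = Y.
Proof.
move=> XY; apply/eqP; rewrite -subr_eq0; apply/eqP; set Z := X - Y.
have Z0 j : Z *m v j = 0.
  rewrite -[LHS](mulKmx (gram_nondegenerate B)); apply/eqP.
  rewrite (_ : B *m _ = 0) ?mulmx0 //; apply: v_inj => i.
  apply/rowP => z; rewrite (ord1 z) !mulmxA -[LHS]/(coef i j Z).
  by rewrite linearB /= XY subrr mxE.
apply: trmx_inj; rewrite trmx0; apply: v_inj => i.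
by rewrite -trmx_mul Z0 trmx0.
Qed.

Lemma v_form_sym i j : b j i = (-1) ^+ par i * b i j.
Proof.
rewrite /form_eval -[LHS]mx11_tr.
rewrite !trmx_mul trmxK gram_tr !mulmxA v_tr_par -!scalemxAl [LHS]mxE.
by [].
Qed.

Lemma v_form_eq0 i j : j != inv i -> b i j = 0.
Proof. by rewrite -v_form_neq0 negbK => /eqP. Qed.

Definition rank1 i j : 'M[K]_(m + k) := v i *m ((v j)^T *m B).

Lemma rank1M i j l r : rank1 i j *m rank1 l r = b j l *: rank1 i r.
Proof.
rewrite /rank1 -!mulmxA [(v j)^T *m _]mulmxA [_ *m (v l *m _)]mulmxA.
rewrite [_ *m v l]mx11_scalar mul_scalar_mx -scalemxAr.
by rewrite /form_eval.
Qed.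

Lemma v_tr_gram_par j :
  (v j)^T *m B *m sgn = (-1) ^+ par j *: ((v j)^T *m B).
Proof. by rewrite -mulmxA -gram_sgn mulmxA v_tr_par -scalemxAl. Qed.

Lemma rank1_shom i j : shom (par i (+) par j) (rank1 i j).
Proof.
apply/shom_sgnP; rewrite /rank1 [LHS]mulmxA v_par -[_ *m sgn]mulmxA.
rewrite v_tr_gram_par -scalemxAl -scalemxAr scalerA.
by rewrite signr_addb -mulrA -signr_addb addbb mulr1.
Qed.

Lemma coef_rank1 i j l r : coef i j (rank1 l r) = b i l * b r j.
Proof.
rewrite /coef /rank1 !mulmxA -[_ *m B *m v j]mulmxA -[_ *m (B *m v j)]mulmxA.
rewrite [_ *m v l]mx11_scalar mul_scalar_mx mxE [_ *m (B *m _)]mulmxA.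
by [].
Qed.

Definition wedge i j : 'M[K]_(m + k) :=
  rank1 i j - (-1) ^+ (par i && par j) *: rank1 j i.

Lemma wedge_shom i j : shom (par i (+) par j) (wedge i j).
Proof.
rewrite /shom /wedge linearB linearZ /=.
by rewrite (eqP (rank1_shom i j)) addbC (eqP (rank1_shom j i)).
Qed.

Lemma rank1_tr i j : (rank1 i j)^T *m B = (-1) ^+ par j *: (B *m rank1 j i).
Proof.
rewrite /rank1 !trmx_mul trmxK gram_tr gram_sgn -[_ *m sgn *m _]mulmxA v_par.
by rewrite -scalemxAr -!scalemxAl !mulmxA.
Qed.

Lemma v_parP p i : sgnmx K m k p *m v i = (-1) ^+ (p && par i) *: v i.
Proof.
case: p => /=; first exact: v_par.
by rewrite /sgnmx -scalar_mx_block mul1mx scale1r.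
Qed.

Lemma v_tr_parP p i :
  (v i)^T *m sgnmx K m k p = (-1) ^+ (p && par i) *: (v i)^T.
Proof.
case: p => /=; first exact: v_tr_par.
by rewrite /sgnmx -scalar_mx_block mulmx1 scale1r.
Qed.

Lemma gram_sgnP p : sgnmx K m k p *m B = B *m sgnmx K m k p.
Proof.
case: p; first exact: gram_sgn.
by rewrite /sgnmx -scalar_mx_block mul1mx mulmx1.
Qed.

Lemma rank1_gram p i j :
  sgnmx K m k p *m B *m rank1 i j = (-1) ^+ (p && par i) *: (B *m rank1 i j).
Proof.
rewrite gram_sgnP /rank1 -[_ *m _ *m (v i *m _)]mulmxA.
by rewrite [sgnmx _ _ _ p *m _]mulmxA v_parP -!scalemxAl -!scalemxAr.
Qed.

Lemma wedge_osp i j : wedge i j \in osp_space B.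
Proof.
apply: (osp_space_homI (wedge_shom i j)).
rewrite /wedge linearB linearZ /= mulmxBl -scalemxAl !rank1_tr.
rewrite mulmxBr -scalemxAr !rank1_gram.
move: (B *m rank1 i j) (B *m rank1 j i) => X Y.
by apply/matrixP => x y; rewrite !mxE; case: (par i); case: (par j) => /=;
  rewrite ?expr0 ?expr1; ring.
Qed.

Lemma wedge_sym i j : wedge j i = - ((-1) ^+ (par i && par j) *: wedge i j).
Proof.
rewrite /wedge andbC; apply/matrixP => x y; rewrite !mxE.
by case: (_ && _); rewrite ?expr0 ?expr1; ring.
Qed.

Lemma wedge_br i j l r : sbracket (wedge i j) (wedge l r) =
  b j l *: wedge i r
  - ((-1) ^+ (par i && par j) * b i l) *: wedge j r
  + (-1) ^+ ((par i (+) par j) && par l) *: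
    (b j r *: wedge l i
     - ((-1) ^+ (par i && par j) * b i r) *: wedge l j).
Proof.
(* The form vanishes between opposite parities; as a 0/1 factor this fact is available to [ring] in
   each of the sixteen parity cases. *)
have b0 i' j' : b i' j' = (par i' == par j')%:R * b i' j'.
  case: eqVneq => [_|n]; first by rewrite mul1r.
  by rewrite mul0r v_form_eq0 //; apply: contraNneq n => ->; rewrite par_inv.
rewrite (sbracket_shom (wedge_shom _ _) (wedge_shom _ _)).
rewrite {1 2 3 4}/wedge; rewrite !(mulmxBl, mulmxBr).
rewrite -!scalemxAl -!scalemxAr !rank1M.
rewrite (v_form_sym i l) (v_form_sym i r) (v_form_sym j l) (v_form_sym j r).
rewrite (b0 i l) (b0 i r) (b0 j l) (b0 j r).
move: (b i l) (b i r) (b j l) (b j r) => bil bir bjl bjr.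
rewrite /wedge.
move: (rank1 i l) (rank1 i r) (rank1 j l) (rank1 j r).
move: (rank1 l i) (rank1 r i) (rank1 l j) (rank1 r j).
move=> S1 S2 S3 S4 S5 S6 S7 S8.
apply/matrixP => x y; rewrite !mxE.
by case: (par i); case: (par j); case: (par l); case: (par r);
  rewrite /= ?expr0 ?expr1; ring.
Qed.

Lemma coef_wedge l r i j : coef l r (wedge i j) =
  b l i * b j r - (-1) ^+ (par i && par j) * (b l j * b i r).
Proof. by rewrite /wedge linearB linearZ /= !coef_rank1. Qed.

Lemma coef_parity i j p X : shom p X -> p != par i (+) par j -> coef i j X = 0.
Proof.
move=> /shom_sgnP Xp np.
have E : (-1) ^+ par i * coef i j X = (-1) ^+ (p (+) par j) * coef i j X.
  transitivity (((v i)^T *m B *m (sgn *m X) *m v j) 0 0).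
    rewrite !mulmxA v_tr_gram_par -!scalemxAl [RHS]mxE.
    by [].
  rewrite Xp -[_ *m v j]mulmxA -scalemxAl -[X *m _ *m _]mulmxA v_par.
  rewrite -!scalemxAr scalerA -signr_addb mulmxA [LHS]mxE.
  by [].
have : coef i j X = - coef i j X.
  move/(congr1 ( *%R ((-1) ^+ par i))): E; rewrite !mulrA -!signr_addb addbb.
  have -> : par i (+) (p (+) par j) = true.
    by move: np; case: p (par i) (par j) {Xp} => [] [] [].
  by rewrite mul1r expr1 mulN1r.
move=> c0; apply/eqP; have /eqP : 2%:R * coef i j X = 0.
  by rewrite mulr_natl mulr2n {1}c0 addNr.
by rewrite mulf_eq0 (negPf two_neq0).
Qed.

(** Only the component of parity p = par i + par j contributes. Moving it across the form costs
    -(-1)^(p par i), and transposing the form costs (-1)^(par j). *)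
Lemma coef_sym i j X : X \in osp_space B ->
  coef j i X = - ((-1) ^+ (par i (+) par j (+) (par i && par j)) * coef i j X).
Proof.
have hom p Y : shom p Y -> Y \in osp_space B ->
  coef j i Y = - ((-1) ^+ (par i (+) par j (+) (par i && par j)) * coef i j Y).
  move=> Yp YB; have [/eqP pij|np] := boolP (p == par i (+) par j); last first.
    rewrite (coef_parity Yp np) (coef_parity Yp) ?mulr0 ?oppr0 //.
    by rewrite addbC.
  have /(congr1 (fun Z => ((v i)^T *m Z *m v j) 0 0)) := osp_space_hom Yp YB.
  rewrite mulmxN mulNmx !mulmxA v_tr_parP -!scalemxAl [RHS]mxE [X in - X]mxE.
  rewrite -/(coef i j Y).
  have -> : ((v i)^T *m Y^T *m B *m v j) 0 0 = (-1) ^+ par j * coef j i Y.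
    by rewrite -[LHS]mx11_tr
      !trmx_mul !trmxK gram_tr !mulmxA v_tr_par -!scalemxAl mxE.
  move=> E; rewrite -[LHS](signrMK (par j)) E pij mulrN mulrA -signr_addb.
  by congr (- ((-1) ^+ _ * _)); case: (par i) (par j) => [] [].
move=> XB; rewrite (spart_sum X).
have := hom _ _ (shom_spart false X) (osp_space_spart false XB).
have := hom _ _ (shom_spart true X) (osp_space_spart true XB).
move: (spart false X) (spart true X) => X0 X1 E1 E0.
by rewrite (linearD (coef j i)) (linearD (coef i j)) /= E0 E1 mulrDr opprD.
Qed.

(** By duality the coefficient at (inv i, inv j) detects v_i ^ v_j, with value b (inv i) i * b j
    (inv j) on the leading rank-one term; the 2 accounts for both orders of the pair. *)
Definition coord i j X : K :=
  coef (inv i) (inv j) X / (2%:R * b (inv i) i * b j (inv j)).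

Lemma v_form_inv_neq0 i : b (inv i) i != 0.
Proof. by rewrite v_form_neq0 invK. Qed.

Lemma sum_form_l (h : I -> K) l : \sum_i h i * b l i = h (inv l) * b l (inv l).
Proof.
rewrite (bigD1 (inv l)) //= big1 ?addr0 // => i il.
by rewrite v_form_eq0 ?mulr0.
Qed.

Lemma sum_form_r (h : I -> K) r : \sum_i h i * b i r = h (inv r) * b (inv r) r.
Proof.
rewrite (bigD1 (inv r)) //= big1 ?addr0 // => i ir.
rewrite v_form_eq0 ?mulr0 //; apply: contraNneq ir => ->.
by rewrite invK.
Qed.

Lemma wedge_expand X : X \in osp_space B ->
  X = \sum_i \sum_j coord i j X *: wedge i j.
Proof.
move=> XB; apply: coef_inj => l r; rewrite linear_sum /=.
transitivity (\sum_i (\sum_j (coord i j X * b l i) * b j r)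
  - \sum_i (\sum_j (coord i j X * (-1) ^+ (par i && par j) * b i r) * b l j)).
  under eq_bigr do rewrite sum_form_r mulrAC.
  under [X in _ - X]eq_bigr do rewrite sum_form_l mulrAC.
  rewrite sum_form_l sum_form_r /coord !par_inv !invK (coef_sym l r XB).
  have := v_form_inv_neq0 l; have := v_form_inv_neq0 r.
  rewrite (v_form_sym (inv l) l) (v_form_sym (inv r) r) !par_inv.
  move: (b (inv l) l) (b (inv r) r) => bl br br0 bl0.
  by case: (par l); case: (par r); rewrite /= ?expr0 ?expr1; field;
    rewrite ?oppr_eq0 ?oner_eq0 ?two_neq0 ?br0 ?bl0.
rewrite -sumrB; apply: eq_bigr => i _.
rewrite linear_sum -sumrB; apply: eq_bigr => j _.
rewrite linearZ /= coef_wedge; ring.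
Qed.

Lemma coord_wedge l r i j : coord l r (wedge i j) = 2%:R^-1 *
  (((i == l) && (j == r))%:R
   - (-1) ^+ (par i && par j) * ((i == r) && (j == l))%:R).
Proof.
have bl l' i' : b (inv l') i' = (i' == l')%:R * b (inv l') l'.
  case: eqVneq => [->|n]; first by rewrite mul1r.
  by rewrite mul0r v_form_eq0 // invK.
have br r' j' : b j' (inv r') = (j' == r')%:R * b r' (inv r').
  case: eqVneq => [->|n]; first by rewrite mul1r.
  by rewrite mul0r v_form_eq0 // (inj_eq (inv_inj invK)) eq_sym.
rewrite /coord coef_wedge (bl l i) (bl l j) (br r i) (br r j).
have := v_form_inv_neq0 l; have := v_form_inv_neq0 r.
rewrite (v_form_sym (inv r) r) par_inv.
move: (b (inv l) l) (b (inv r) r) => c d d0 c0.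
rewrite -!mulnb !natrM.
by case: (par r); rewrite ?expr0 ?expr1; field;
  rewrite ?oppr_eq0 ?oner_eq0 ?two_neq0 ?c0 ?d0.
Qed.

(** The two rank-one terms contribute equally by [coef_sym]; with the 2 in the denominator of
    [coord] this makes 4. *)
Lemma str_wedge X l r : X \in osp_space B ->
  \tr (sgn *m X *m wedge l r)
  = 4%:R * b (inv l) l * b (inv r) r * coord (inv r) (inv l) X.
Proof.
move=> XB; have tr_rank1 i j :
    \tr (sgn *m X *m rank1 i j) = (-1) ^+ par j * coef j i X.
  rewrite /rank1 [_ *m (v i *m _)]mulmxA mxtrace_mulC trace_mx11.
  by rewrite !mulmxA v_tr_gram_par -!scalemxAl mxE.
rewrite /wedge mulmxBr -scalemxAr linearB linearZ /= !tr_rank1 /coord !invK.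
rewrite (coef_sym r l XB).
have := v_form_inv_neq0 l; have := v_form_inv_neq0 r.
rewrite (v_form_sym (inv r) r) !par_inv.
move: (b (inv l) l) (b (inv r) r) => c d d0 c0.
by case: (par l); case: (par r); rewrite /= ?expr0 ?expr1; field;
  rewrite ?oppr_eq0 ?oner_eq0 ?two_neq0 ?c0 ?d0.
Qed.

Definition wedge_vec i j : V := Subvs (wedge_osp i j).

Definition wedge_coord i j (x : V) : K := coord i j (vsval x).

Lemma wedge_coord_linear i j : scalar (wedge_coord i j).
Proof.
move=> t x y; rewrite /wedge_coord /coord osp_vsvalP linearP /=.
by rewrite mulrDl mulrA.
Qed.
HB.instance Definition _ i j := GRing.isLinear.Build K V K *%R
  (wedge_coord i j) (wedge_coord_linear i j).

Definition osp_wedge_basis : osp_basis V inv par.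
Proof.
apply: (@OspBasis K V I inv par (fun i j => b i j) wedge_vec
  (fun i j => wedge_coord i j)) => //.
- exact: v_form_sym.
- by move=> i j; rewrite [_ \in _]osp_partP wedge_shom.
- by move=> i j; apply: val_inj; apply: wedge_sym.
- by move=> i j l r; apply: val_inj; apply: wedge_br.
- move=> x; apply: val_inj; rewrite [LHS](wedge_expand (subvsP x)).
  rewrite [RHS](linear_sum (@vsval _ _ (osp_space B))); apply: eq_bigr => i _.
  by rewrite [RHS](linear_sum (@vsval _ _ (osp_space B))).
- by move=> l r i j; apply: coord_wedge.
Defined.

End OspBasisOfForm.

(** * Homogeneous hyperbolic bases of K^(m|k) *)

Section SuperHyperbolicBasis.

Variables (K : closedFieldType) (m k : nat) (B : superform K m k).
Hypothesis two_neq0 : 2%:R != 0 :> K.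

Let I : finType := ('I_m + 'I_k)%type.

Definition super_inv (i : I) : I :=
  match i with inl j => inl (rev_ord j) | inr j => inr (rev_ord j) end.

Definition super_par (i : I) : bool := if i is inr _ then true else false.

Lemma super_invK : involutive super_inv.
Proof. by case=> i /=; rewrite rev_ordK. Qed.

Lemma super_par_inv i : super_par (super_inv i) = super_par i.
Proof. by case: i. Qed.

Lemma gram_blocks :
  gram B = block_mx (ulsubmx (gram B)) 0 0 (drsubmx (gram B)).
Proof. by have [e1 e2] := gram_even B; rewrite -[LHS]submxK e1 e2. Qed.

Lemma gram_blocks_unit :
  ulsubmx (gram B) \in unitmx /\ drsubmx (gram B) \in unitmx.
Proof.
have := gram_nondegenerate B.
rewrite unitmxE {1}gram_blocks det_ublock unitrM => /andP[].
by rewrite !unitmxE.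
Qed.

Lemma form_eval_up (u : 'cV[K]_m) (x : 'cV[K]_(m + k)) :
  form_eval B (col_mx u 0) x = gram_form (ulsubmx B) u (usubmx x).
Proof.
rewrite /form_eval [in LHS]gram_blocks -[x in LHS]vsubmxK tr_col_mx trmx0.
rewrite mul_row_block !(mul0mx, mulmx0, addr0) mul_row_col mul0mx addr0.
by [].
Qed.

Lemma form_eval_down (u : 'cV[K]_k) (x : 'cV[K]_(m + k)) :
  form_eval B (col_mx 0 u) x = gram_form (drsubmx B) u (dsubmx x).
Proof.
rewrite /form_eval [in LHS]gram_blocks -[x in LHS]vsubmxK tr_col_mx trmx0.
rewrite mul_row_block !(mul0mx, mulmx0, add0r) mul_row_col mul0mx add0r.
by [].
Qed.

Lemma super_hyperbolic_basis : exists v : I -> 'cV[K]_(m + k),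
  [/\ forall i j, (form_eval B (v i) (v j) != 0) = (j == super_inv i),
      forall i, sgnmx K m k true *m v i = (-1) ^+ super_par i *: v i
    & forall q (Y : 'M[K]_(m + k, q)), (forall i, (v i)^T *m Y = 0) -> Y = 0].
Proof.
have [ul_unit dr_unit] := gram_blocks_unit.
have ul_sym : (ulsubmx B)^T = (-1) ^+ false *: ulsubmx B.
  by rewrite scale1r gram_sym.
have dr_sym : (drsubmx B)^T = (-1) ^+ true *: drsubmx B.
  by rewrite expr1 scaleN1r gram_antisym.
have [e [eB e0]] := hyperbolic_basis two_neq0 ul_sym ul_unit.
have [o [oB o0]] := hyperbolic_basis two_neq0 dr_sym dr_unit.
pose v (i : I) : 'cV[K]_(m + k) :=
  match i with inl j => col_mx (e j) 0 | inr j => col_mx 0 (o j) end.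
exists v; split=> [[i|i] [j|j]|[i|i]|q Y Y0].
- by rewrite form_eval_up col_mxKu eB.
- by rewrite form_eval_up col_mxKu /gram_form mulmx0 mxE eqxx.
- by rewrite form_eval_down col_mxKd /gram_form mulmx0 mxE eqxx.
- by rewrite form_eval_down col_mxKd oB.
- by rewrite /sgnmx mul_block_col !(mul0mx, mulmx0, addr0) mul1mx scale1r.
- rewrite /sgnmx mul_block_col !(mul0mx, mulmx0, add0r) mul_scalar_mx.
  by rewrite expr1 scale_col_mx scaler0.
(* Separation is known for the form, not for the bare product with Y, so it is applied to the
   columns of B^-1 Y. *)
have form0 i l : form_eval B (v i) (col l (invmx B *m Y)) = 0.
  rewrite /form_eval colE -[_ *m B *m _]mulmxA [B *m _]mulmxA.
  rewrite mulKVmx ?(gram_nondegenerate B) //.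
  by rewrite mulmxA Y0 mul0mx mxE.
have BY0 : invmx B *m Y = 0.
  apply/matrixP => i l; rewrite [RHS]mxE.
  have -> : (invmx B *m Y) i l = col l (invmx B *m Y) i 0 by rewrite [RHS]mxE.
  rewrite -[col l _]vsubmxK (e0 (usubmx _)) => [|r]; last first.
    by rewrite -form_eval_up (form0 (inl r)).
  rewrite (o0 (dsubmx _)) => [|r]; last first.
    by rewrite -form_eval_down (form0 (inr r)).
  by rewrite col_mx0 mxE.
by rewrite -[LHS](mulKVmx (gram_nondegenerate B)) BY0 mulmx0.
Qed.

(** A fixed odd index would give a vector with nonzero square for an antisymmetric form. *)
Lemma super_inv_odd i : super_par i -> super_inv i != i.
Proof.
case: i => // i _; rewrite (inj_eq inr_inj) /=.
have [_ dr_unit] := gram_blocks_unit.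
have dr_sym : (drsubmx B)^T = (-1) ^+ true *: drsubmx B.
  by rewrite expr1 scaleN1r gram_antisym.
have [o [oB _]] := hyperbolic_basis two_neq0 dr_sym dr_unit.
have := gram_form_sym dr_sym (o i) (o i); rewrite expr1 mulN1r => oi.
have /eqP : 2%:R * gram_form (drsubmx B) (o i) (o i) = 0.
  by rewrite mulr_natl mulr2n {1}oi addNr.
by rewrite mulf_eq0 (negPf two_neq0) [rev_ord i == i]eq_sym -oB => /= ->.
Qed.

End SuperHyperbolicBasis.

Theorem lemma2p24 (K : closedFieldType) (charK : 5%N \in [pchar K]%R)
    (m k : nat)
    (mk : (m, k) \in [:: (1, 8); (2, 6); (3, 6); (4, 4); (5, 2)]%N)
    (B : superform K m k) :
  H1_adjoint_eq0 (osp B) /\ H2_trivial_eq0 (osp B).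
Proof.
have two_neq0 : 2%:R != 0 :> K by rewrite -(dvdn_pcharf charK).
have [m_gt0 k_gt0] : (0 < m)%N /\ (0 < k)%N.
  by move: mk; rewrite !inE => /or4P[|||/orP[]] /eqP[-> ->].
pose i0 : 'I_m + 'I_k := inl (Ordinal m_gt0).
pose o0 : 'I_m + 'I_k := inr (Ordinal k_gt0).
have [v [v_form v_par v_inj]] := super_hyperbolic_basis B two_neq0.
have inv_odd := super_inv_odd B two_neq0.
(* Only the middle even index can be fixed, and only when m is odd. *)
have inv_fixed (i j : 'I_m + 'I_k) :
    super_inv i = i -> super_inv j = j -> i = j.
  case: i j => [i|i] [j|j] ii jj.
  - congr inl; apply: val_inj; have /(congr1 val) /= ri := inl_inj ii.
    have /(congr1 val) /= rj := inl_inj jj.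
    by have := ltn_ord i; have := ltn_ord j; lia.
  - by have := inv_odd (inr j) isT; rewrite jj eqxx.
  - by have := inv_odd (inr i) isT; rewrite ii eqxx.
  - by have := inv_odd (inr i) isT; rewrite ii eqxx.
pose ob := osp_wedge_basis two_neq0 (@super_invK m k) inv_fixed
  (@super_par_inv m k) inv_odd v_form v_par v_inj.
have inner (D : 'End(osp B)) : crossed D -> inner_derivation D.
  exact: (@crossed_inner _ _ _ _ _ ob i0 o0).
split=> [D /derivation_crossed/inner //|].
(* The scale below is the factor in [str_wedge]; it is nonzero because 4 is invertible in
   characteristic 5. *)
pose b i j := form_eval B (v i) (v j).
apply: (@H2_eq0_crossed _ _ _ _ _ ob (supertrace_form (B := B))
  (fun i j => 4%:R * b (super_inv i) i * b (super_inv j) j)) => //.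
- exact: supertrace_form_br.
- by move=> i j; rewrite mulrAC.
- move=> i j; rewrite !mulf_neq0 ?v_form ?super_invK ?eqxx //.
  by rewrite -(dvdn_pcharf charK).
- move=> x i j; apply: str_wedge => //; last exact: subvsP.
    exact: super_invK.
  exact: super_par_inv.
Qed.
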